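(* Consider the nonstandard renewal risk model in Case 1 (described in the context). Let $Y_i$, $i\ge1$, be ENOD random variables with a common distribution $G\in\mathcal C$, and let $Z_i$, $i\ge1$, be WOD random variables with a common distribution $H$ and dominating coefficients $g_{L,H}(n),g_{U,H}(n)$, $n\ge1$. Assume that there exist some almost increasing function $g(\cdot)$, some integer $l\ge1$ and some $\omega\in(0,1)$ such that $EZ_1g(Z_1)<\infty$ and $$\frac{x^{l-1}}{g(x)}\ \overline{\downarrow}\ 0,\qquad \frac{g(x)}{x^{l-1+\omega}}\ \overline{\downarrow}\ 0\qquad\text{and}\qquad \max\{g_{U,H}(n),g_{L,H}(n)\}\le g(n),\quad n\ge1.$$ Further, if $\overline H(x)=o(\overline G(x))$ and $P(\tau>x)=o(\overline G(x))$ as $x\to\infty$, then $\max\{E\tau,EN(\tau)\}<\infty$ and $$\psi(x;\tau)\sim EN(\tau)\,\overline G(x),\qquad x\to\infty.$$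
   Context: Notation: for a distribution $F$, $\overline F=1-F$ is its tail, and for $y\in(0,\infty)$, $\overline{F_*}(y)=\liminf_{x\to\infty}\overline F(xy)/\overline F(x)$. The class $\mathcal C$ (consistently varying tails) consists of the distributions $F$ with $\lim_{y\downarrow 1}\overline{F_*}(y)=1$. A positive function $g$ is almost decreasing, written $g(x)\,\overline{\downarrow}$, if there are finite constants $x_0,C>0$ with $\sup_{x_0\le x\le y}g(y)/g(x)\le C$; $g(x)\,\overline\downarrow\,0$ means that $g$ is almost decreasing and tends to $0$ as $x\to\infty$; $g$ is almost increasing if $1/g$ is almost decreasing. Dependence: random variables $X_i$, $i\ge1$, are WOD (widely orthant dependent) with dominating coefficients $g_U(n),g_L(n)>0$, $n\ge1$, if for each $n\ge1$ and all real $x_1,\dots,x_n$, $P(\bigcap_{i=1}^n\{X_i>x_i\})\le g_U(n)\prod_{i=1}^nP(X_i>x_i)$ and $P(\bigcap_{i=1}^n\{X_i\le x_i\})\le g_L(n)\prod_{i=1}^nP(X_i\le x_i)$ (for the $Z_i$ these coefficients are denoted $g_{U,H},g_{L,H}$). They are ENOD (extended negatively orthant dependent) if this holds with $g_U(n)=g_L(n)=M$ for all $n$ and some constant $M>0$. Renewal risk model: claim sizes $Y_i$, $i\ge1$, are random variables with common distribution $G$ on $[0,\infty)$ and mean $0<\mu_G<\infty$; inter-arrival times $Z_i$, $i\ge1$, are random variables with common distribution $H$ on $[0,\infty)$ and mean $0<\mu_H<\infty$; $\tau$ is a nonnegative random variable (random time). $N(t)=\sum_{n\ge1}\mathbf 1_{\{Z_1+\cdots+Z_n\le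 t\}}$, $\lambda(t)=EN(t)$, with $\inf\{t:0<\lambda(t)<\infty\}=0$. The positive constant $c$ satisfies the safety loading condition $\mu_G<c\mu_H$. The random-time ruin probability is $\psi(x;\tau)=P\big(\max_{0\le n\le N(\tau)}\sum_{i=1}^n(Y_i-cZ_i)>x\big)$, $x\ge0$ (empty sum $=0$). Case 1 of the nonstandard model: $\{Y_i,i\ge1\}$, $\{Z_i,i\ge1\}$ and $\tau$ are independent of each other, but at least one of $\{Y_i\}$ and $\{Z_i\}$ is a dependent sequence. *)

(* Defs.v *)
From HB Require Import structures.
From mathcomp Require Import all_boot all_order all_algebra.
From mathcomp Require Import all_classical all_reals all_analysis.

Set Implicit Arguments.
Unset Strict Implicit.
Unset Printing Implicit Defensive.

Import Order.TTheory GRing.Theory Num.Theory.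
Import numFieldNormedType.Exports.

Local Open Scope classical_set_scope.
Local Open Scope ring_scope.

(* Sequences written X_1, X_2, ... in the probabilistic literature are indexed
   from 0 here: X i stands for X_(i+1), and \sum_(i < n) X i is the sum of the
   first n terms. *)

(* Lets the Landau notations be used as x tends to +oo. *)
Canonical pinfty_filter_on (R : numFieldType) :=
  @FilterType R (pinfty_nbhs R) _.

Section Tails.
Variable R : realType.

Definition supported_nneg (F : probability (measurableTypeR R) R) : Prop :=
  F `[0, +oo[%classic = 1%E.

Definition mean (F : probability (measurableTypeR R) R) : \bar R :=
  (\int[F]_x x%:E)%E.

Definition tail (F : probability (measurableTypeR R) R) (x : R) : R :=
  1 - fine (F `]-oo, x]%classic).

Definition tail_lower (F : probability (measurableTypeR R) R) (y : R) : \bar R :=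
  limf_einf (fun x : R => (tail F (x * y) / tail F x)%:E) (pinfty_nbhs R).

(* The class C. Since 0 / 0 = 0, membership forces tail F x > 0 for all x: if
   the tail vanished from some point on, tail_lower F would be constantly 0. *)
Definition consistently_varying (F : probability (measurableTypeR R) R) : Prop :=
  tail_lower F y @[y --> 1^'+] --> 1%E.

(* These are meant for functions that are positive on the positive half-line;
   positivity is assumed separately where it is needed. The inequality says
   that the supremum of f y / f x over x0 <= x <= y is at most C. *)
Definition almost_decreasing (f : R -> R) : Prop :=
  exists x0 C : R, [/\ 0 < x0, 0 < C &
    forall x y, x0 <= x -> x <= y -> f y / f x <= C].

Definition almost_decreasing_to0 (f : R -> R) : Prop :=
  almost_decreasing f /\ f x @[x --> +oo%R] --> (0 : R).

Definition almost_increasing (f : R -> R) : Prop :=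
  almost_decreasing (fun x => (f x)^-1).

End Tails.

Section Dependence.
Context (R : realType) (d : measure_display) (T : measurableType d).
Variable P : probability T R.

Definition identically_distributed (X : nat -> {RV P >-> R})
    (F : probability (measurableTypeR R) R) : Prop :=
  forall i (B : set R), measurable B -> distribution P (X i) B = F B.

(* Widely orthant dependent with dominating coefficients gU, gL. *)
Definition WOD (X : nat -> {RV P >-> R}) (gU gL : nat -> R) : Prop :=
  forall n, (1 <= n)%N ->
  [/\ 0 < gU n, 0 < gL n &
    forall x : nat -> R,
      fine (P (\bigcap_(i < n) [set w | x i < X i w])) <=
        gU n * \prod_(i < n) fine (P [set w | x i < X i w]) /\
      fine (P (\bigcap_(i < n) [set w | X i w <= x i])) <=
        gL n * \prod_(i < n) fine (P [set w | X i w <= x i])].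

(* Extended negatively orthant dependent. *)
Definition ENOD (X : nat -> {RV P >-> R}) : Prop :=
  exists2 M : R, 0 < M & WOD X (fun=> M) (fun=> M).

(* Initial segments suffice: taking B i = setT drops an index. *)
Definition independent_seq (X : nat -> {RV P >-> R}) : Prop :=
  forall (n : nat) (B : nat -> set R), (forall i, measurable (B i)) ->
    fine (P (\bigcap_(i < n) (X i @^-1` B i))) =
      \prod_(i < n) fine (P (X i @^-1` B i)).

Definition sigma_seq (X : nat -> {RV P >-> R}) : set (set T) :=
  <<s \bigcup_i preimage_set_system setT (X i) (@measurable _ (measurableTypeR R)) >>.

Definition sigma_rv (X : {RV P >-> R}) : set (set T) :=
  preimage_set_system setT X (@measurable _ (measurableTypeR R)).

(* Mutual independence; the product rule for two of the three sigma-algebras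
   is the case where the third event is setT. *)
Definition independent3 (A1 A2 A3 : set (set T)) : Prop :=
  forall E1 E2 E3, A1 E1 -> A2 E2 -> A3 E3 ->
    (P (E1 `&` E2 `&` E3) = P E1 * P E2 * P E3)%E.

End Dependence.

Section RenewalRisk.
Context (R : realType) (d : measure_display) (T : measurableType d).
Variable P : probability T R.
Variables (Y Z : nat -> {RV P >-> R}) (tau : {RV P >-> R}) (c : R).

(* N(t); extended-real valued, because for some outcomes infinitely many
   partial sums may be <= t. *)
Definition renewal_count (t : R) (w : T) : \bar R :=
  (\sum_(1 <= n <oo) (\1_[set v | (\sum_(i < n) Z i v <= t)%R] w)%:E)%E.

Definition renewal_fun (t : R) : \bar R := (\int[P]_w renewal_count t w)%E.

Definition mean_count : \bar R := (\int[P]_w renewal_count (tau w) w)%E.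

Definition net_loss (n : nat) (w : T) : R := \sum_(i < n) (Y i w - c * Z i w).

Definition max_net_loss (w : T) : \bar R :=
  ereal_sup [set (net_loss n w)%:E |
    n in [set n : nat | (n%:R%:E <= renewal_count (tau w) w)%E]].

Definition ruin_prob (x : R) : R :=
  fine (P [set w | (x%:E < max_net_loss w)%E]).

End RenewalRisk.

(* Main.v *)
Require Import Defs.
From HB Require Import structures.
From mathcomp Require Import all_boot all_order all_algebra.
From mathcomp Require Import all_classical all_reals all_analysis measurable_realfun.
From mathcomp Require Import ring lra.

Set Implicit Arguments.
Unset Strict Implicit.
Unset Printing Implicit Defensive.

Import Order.TTheory GRing.Theory Num.Theory.
Import numFieldNormedType.Exports.

Local Open Scope classical_set_scope.
Local Open Scope ring_scope.

(** Write S_n for the sum of the first n claims, N for N(tau) and Gbar for the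
tail of G. A premium rate c > 0 only helps the company, and the N renewals
before tau satisfy Z_1 + ... + Z_N <= tau; hence
  S_N - c * tau <= (maximal net loss up to N) <= S_N.
Ruin is therefore governed by the tail of the random sum S_N, where N depends
on (Z, tau) only and so is independent of the claims. For consistently varying
Gbar, shifting x by c * tau is harmless once tau is bounded, and the theorem
reduces to P(S_N > x) ~ E N * Gbar(x). Four facts give this.

- N has a lighter tail than the claims. If N >= n, then either tau > a * n or n
  inter-arrival times add up to at most a * n. For small a, lower orthant
  dependence bounds the probability of the second event by g_L(n) times a
  geometric sequence ([small_sum_bound]), and g_L grows at most polynomially. Since
  Gbar decays at most polynomially ([potter], [potter_poly]), P(N >= n) is
  o(Gbar(n)) ([renewed_prob_small]). As Gbar is summable, E N and E tau are
  finite.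

- For fixed n, P(S_n > x) <= (n + o(1)) * Gbar(x): either one claim exceeds
  (1 - eps) * x, or two claims exceed eps * x / n, and the latter has
  probability O(Gbar(x)^2) ([fixed_sum_bound]).

- Uniformly in n, P(S_n > x) <= n * Gbar(x / (r+1)) + C * (n / x)^r for every r
  ([large_sum_bound]): if all claims are at most x / (r+1), then at least
  r + 1 of them must cooperate to exceed x. Weighted with P(N = n), the first
  term is O(Gbar(x)) times the tail of a convergent series; the second is
  o(Gbar(x)) once r exceeds the polynomial order p of Gbar, by summation by
  parts and P(N >= n) = o(Gbar(n)) ([truncated_moment_small]). The upper bound
  follows ([random_sum_tail]).

- For the lower bound, it is enough that one claim before the N-th renewal
  exceeds x + c * t while tau <= t. Inclusion-exclusion costs only the event
  that two claims are this large ([ruin_prob_ge], [ruin_lower]).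

All expectations under orthant dependence reduce to [orthant_prod_bound]: a
product of nonnegative combinations of indicators of orthant events expands
into a sum over orthants, so its expectation is at most M times the product of
the expectations. *)

(** * Union bounds and products of orthant indicators *)

Section ProbabilityBounds.
Context (R : realType) (d : measure_display) (T : measurableType d).
Variable P : probability T R.

Lemma fine_prob_ge0 (A : set T) : 0 <= fine (P A).
Proof. exact/fine_ge0/measure_ge0. Qed.

Lemma fine_probK (A : set T) : measurable A -> (fine (P A))%:E = P A.
Proof. by move=> mA; rewrite fineK// fin_num_measure. Qed.

Lemma fine_prob_le1 (A : set T) : measurable A -> fine (P A) <= 1.
Proof. by move=> mA; rewrite -lee_fin fine_probK// probability_le1. Qed.

Lemma fine_probC (A : set T) : measurable A -> fine (P (~` A)) = 1 - fine (P A).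
Proof. by move=> mA; rewrite probability_setC// -fine_probK// -EFinB. Qed.

Lemma ae_imply (Q1 Q2 : T -> Prop) : (forall w, Q1 w -> Q2 w) ->
  {ae P, forall w, Q1 w} -> {ae P, forall w, Q2 w}.
Proof. by move=> Q12; apply: filterS. Qed.

Lemma integral_weighted_indic (I : finType) (c : I -> R) (C : I -> set T) :
  (forall i, 0 <= c i) -> (forall i, measurable (C i)) ->
  (\int[P]_w (\sum_i c i * \1_(C i) w)%:E = (\sum_i c i * fine (P (C i)))%:E)%E.
Proof.
move=> c0 mC.
have mf i : measurable_fun setT (fun w => (c i * \1_(C i) w)%:E).
  by apply/measurable_EFinP; apply: measurable_funM => //; exact: measurable_indic.
under eq_integral do rewrite -sumEFin.
rewrite ge0_integral_sum//; last by move=> i w _; rewrite lee_fin mulr_ge0.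
rewrite -sumEFin; apply: eq_bigr => i _.
rewrite EFinM fine_probK// -[in RHS](setIT (C i)) -integral_indic//.
under eq_integral do rewrite EFinM.
rewrite ge0_integralZl//.
- by apply/measurable_EFinP/measurable_indic.
- by rewrite lee_fin.
Qed.

Lemma measurable_weighted_indic (I : finType) (c : I -> R) (C : I -> set T) :
  (forall i, measurable (C i)) ->
  measurable_fun setT (fun w => \sum_i c i * \1_(C i) w).
Proof.
move=> mC; apply: measurable_sum => i.
by apply: measurable_funM => //; exact: measurable_indic.
Qed.

(** Inequalities between finite combinations of indicators integrate; union bounds,
Markov-type bounds and Bonferroni-type bounds below are all of this form. *)
Lemma weighted_indic_le (I J : finType) (c : I -> R) (C : I -> set T)
    (e : J -> R) (D : J -> set T) :
  (forall i, 0 <= c i) -> (forall i, measurable (C i)) ->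
  (forall j, 0 <= e j) -> (forall j, measurable (D j)) ->
  {ae P, forall w, \sum_i c i * \1_(C i) w <= \sum_j e j * \1_(D j) w} ->
  \sum_i c i * fine (P (C i)) <= \sum_j e j * fine (P (D j)).
Proof.
move=> c0 mC e0 mD h.
rewrite -lee_fin -!integral_weighted_indic//; apply: ae_ge0_le_integral => //.
- by move=> w _; rewrite lee_fin sumr_ge0// => i _; rewrite mulr_ge0.
- by apply/measurable_EFinP; exact: measurable_weighted_indic.
- by move=> w _; rewrite lee_fin sumr_ge0// => i _; rewrite mulr_ge0.
- by apply/measurable_EFinP; exact: measurable_weighted_indic.
- by apply: filterS h => w h _; rewrite lee_fin.
Qed.

Lemma weighted_union_bound (I : finType) (c : I -> R) (C : I -> set T)
    (A : set T) (lam : R) :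
  0 <= lam -> (forall i, 0 <= c i) -> (forall i, measurable (C i)) ->
  measurable A ->
  {ae P, forall w, A w -> lam <= \sum_i c i * \1_(C i) w} ->
  lam * fine (P A) <= \sum_i c i * fine (P (C i)).
Proof.
move=> lam0 c0 mC mA h.
have := @weighted_indic_le 'I_1 I (fun=> lam) (fun=> A) c C (fun=> lam0) (fun=> mA) c0 mC.
rewrite big_ord1; apply; apply: filterS h => w h; rewrite big_ord1 indicE.
case: (boolP (w \in A)) => [/set_mem|_]; first by rewrite mulr1; exact: h.
by rewrite mulr0; apply: sumr_ge0 => i _; rewrite mulr_ge0.
Qed.

Lemma le_fine_prob_ae (A B : set T) : measurable A -> measurable B ->
  {ae P, forall w, A w -> B w} -> fine (P A) <= fine (P B).
Proof.
move=> mA mB h.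
have := @weighted_union_bound 'I_1 (fun=> 1) (fun=> B) A 1 ler01 (fun=> ler01) (fun=> mB) mA.
rewrite !big_ord1 !mul1r; apply; apply: filterS h => w h /h Bw.
by rewrite big_ord1 mul1r indicE mem_set.
Qed.

Lemma union_bound_ae n (C : nat -> set T) (A B : set T) :
  (forall i, measurable (C i)) -> measurable A -> measurable B ->
  {ae P, forall w, A w -> B w \/ exists2 i, (i < n)%N & C i w} ->
  fine (P A) <= fine (P B) + \sum_(i < n) fine (P (C i)).
Proof.
move=> mC mA mB h.
pose C' k := if k is j.+1 then C j else B.
have -> : fine (P B) + \sum_(i < n) fine (P (C i)) =
    \sum_(i < n.+1) 1 * fine (P (C' i)).
  by rewrite big_ord_recl mul1r; congr (_ + _); apply: eq_bigr => i _; rewrite mul1r.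
rewrite -[leLHS]mul1r; apply: weighted_union_bound => //.
  by case=> -[|i] ? /=; [exact: mB|exact: mC].
apply: filterS h => w /[apply].
have C'0 (i : 'I_n.+1) : 0 <= 1 * \1_(C' i) w :> R by rewrite mul1r.
have C'1 i : (i < n.+1)%N -> C' i w -> 1 <= \sum_(i < n.+1) 1 * \1_(C' i) w :> R.
  move=> i_n C'w; rewrite (bigD1 (Ordinal i_n))//= mul1r indicE mem_set//.
  by rewrite lerDl sumr_ge0.
by case=> [Bw|[i i_n Ciw]]; [exact: (C'1 0)|exact: (C'1 i.+1)].
Qed.

(** Expanding the product over i turns the right-hand side of the pointwise bound
into a combination of indicators of intersections, one for each choice k of an
event per index; the dependence hypothesis bounds each term and the product is
folded back. *)
Lemma orthant_prod_bound n m (M lam : R) (a : 'I_m.+1 -> R)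
    (E : nat -> 'I_m.+1 -> set T) (A : set T) :
  0 <= lam -> (forall k, 0 <= a k) -> (forall i k, measurable (E i k)) -> measurable A ->
  (forall k : nat -> 'I_m.+1, fine (P (\bigcap_(i < n) E i (k i))) <=
     M * \prod_(i < n) fine (P (E i (k i)))) ->
  {ae P, forall w, A w -> lam <= \prod_(i < n) \sum_k a k * \1_(E i k) w} ->
  lam * fine (P A) <= M * \prod_(i < n) \sum_k a k * fine (P (E i k)).
Proof.
move=> lam0 a0 mE mA EM h.
(* Choices are finite functions in the expansion, total functions in EM. *)
pose ext (f : {ffun 'I_n -> 'I_m.+1}) (i : nat) : 'I_m.+1 :=
  if insub i is Some j then f j else ord0.
have extE f (i : 'I_n) : ext f i = f i by rewrite /ext valK.
have := @weighted_union_bound {ffun 'I_n -> 'I_m.+1}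
  (fun f => \prod_(i < n) a (f i))
  (fun f => \bigcap_(i < n) E i (ext f i)) A lam.
move=> H; apply: le_trans (H _ _ _ _ _) _ => //.
- by move=> f; apply: prodr_ge0.
- by move=> f; apply: bigcap_measurableType => i _; exact: mE.
- apply: filterS h => w h /h /le_trans; apply.
  rewrite bigA_distr_bigA/=; apply: ler_sum => f _.
  rewrite big_split/= ler_wpM2l ?prodr_ge0//.
  rewrite [leRHS]indicE; case: (boolP (w \in _)) => [|/negP wE].
    move=> _; apply: prodr_ile1 => i _; rewrite indicE.
    by case: (w \in _); rewrite !lexx ler01.
  have [i Ei] : exists i : 'I_n, ~ E i (f i) w.
    apply: contrapT => /forallNP Ei; apply: wE; apply: mem_set => i /= i_n.
    by have /contrapT := Ei (Ordinal i_n); rewrite -(extE f (Ordinal i_n)).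
  rewrite (bigD1 i)//= indicE memNset// mul0r //.
- rewrite bigA_distr_bigA mulr_sumr; apply: ler_sum => f _.
  rewrite big_split/= mulrCA ler_wpM2l ?prodr_ge0//.
  apply: le_trans (EM (ext f)) _; rewrite le_eqVlt; apply/orP; left; apply/eqP.
  by congr (_ * _); apply: eq_bigr => i _; rewrite extE.
Qed.

End ProbabilityBounds.

(** * Elementary inequalities *)

Section Inequalities.
Variable R : realType.
Implicit Types (t u w h : R).

(** The convexity of exp on the segment from 0 to u, obtained by averaging the two
inequalities exp v >= exp z * (1 + (v - z)) at v = 0 and v = u. *)
Lemma expR_chord t u : 0 <= t <= 1 -> expR (t * u) <= 1 + t * (expR u - 1).
Proof.
move=> /andP[t0 t1]; set z := t * u.
have e0 : expR z * (1 - z) <= 1.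
  rewrite -(expRK z) -[X in _ <= X](mulfV (lt0r_neq0 (expR_gt0 z))).
  by rewrite expRK ler_pM2l ?expR_gt0// -expRN expR_ge1Dx.
have e1 : expR z * (1 + (u - z)) <= expR u.
  rewrite -[X in _ <= expR X](subrKC z u) expRD ler_pM2l ?expR_gt0//.
  exact: expR_ge1Dx.
have := lerD (ler_wpM2l (_ : 0 <= 1 - t) e0) (ler_wpM2l t0 e1).
rewrite subr_ge0 => /(_ t1).
have -> : (1 - t) * (expR z * (1 - z)) + t * (expR z * (1 + (u - z))) = expR z.
  by rewrite /z; ring.
by move=> /le_trans; apply; lra.
Qed.

(** Since 1 + w * W >= (1 + w) ^ W for W in [0, 1], the product dominates (1 + w) to
the power of the sum. The left factor is affine in each W, which is what makes
it a combination of indicators when W counts thresholds. *)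
Lemma bernoulli_prod n r (W : nat -> R) w : 0 <= w ->
  (forall i, 0 <= W i <= 1) -> r%:R <= \sum_(i < n) W i ->
  (1 + w) ^+ r <= \prod_(i < n) (1 + w * W i).
Proof.
move=> w0 W01 rW.
have w1 : 0 < 1 + w by lra.
have -> : (1 + w) ^+ r = expR (r%:R * ln (1 + w)) by rewrite expRM_natl lnK.
have ln0 : 0 <= ln (1 + w) by rewrite ln_ge0// lerDl.
apply: (@le_trans _ _ (expR (\sum_(i < n) W i * ln (1 + w)))).
  by rewrite ler_expR -mulr_suml ler_wpM2r.
rewrite expR_sum; apply: ler_prod => i _; rewrite expR_ge0/=.
by have := expR_chord (ln (1 + w)) (W01 i); rewrite lnK//
  (_ : 1 + W i * (1 + w - 1) = 1 + w * W i) //; ring.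
Qed.

(** Discretization with mesh h: counting the thresholds h, 2h, ..., m*h below t
recovers t from below up to an error of one mesh. *)
Lemma sum_steps_ge m h t : 0 <= h -> t <= m%:R * h ->
  t <= h + h * \sum_(k < m) ((k.+1%:R * h < t)%R)%:R.
Proof.
move=> h0; elim: m => [|m IH] tm; first by move: tm; rewrite big_ord0; lra.
rewrite big_ord_recr/=; have [tm'|tm'] := leP t (m%:R * h).
  apply: (le_trans (IH tm')); rewrite lerD2l ler_wpM2l// lerDl //.
rewrite (eq_bigr (fun=> 1)); last first.
  move=> k _; rewrite (le_lt_trans _ tm')// ler_wpM2r// ler_nat//.
rewrite sumr_const card_ord.
have : 0 <= h * ((m.+1%:R * h < t)%R)%:R by rewrite mulr_ge0.
move: tm; rewrite -natr1 mulrDr mulrDl mul1r mulrC; lra.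
Qed.

Lemma sum_steps_le m h t : 0 <= h -> 0 <= t ->
  h * \sum_(k < m) ((k.+1%:R * h < t)%R)%:R <= t.
Proof.
move=> h0 t0; elim: m => [|m IH]; first by rewrite big_ord0 mulr0.
rewrite big_ord_recr/=; have [tm|tm] := ltP (m.+1%:R * h) t; last by rewrite addr0.
apply: le_trans (ltW tm); rewrite mulrC ler_wpM2r// -natr1 lerD2r.
rewrite -[leRHS](@mulr1 _) mulr_natl -[X in _ *+ X](card_ord m) -sumr_const.
by apply: ler_sum => i _; case: ltP.
Qed.

End Inequalities.

(** * Measurability of comparisons and partial sums *)

Section Measurability.
Context (R : realType) (d : measure_display) (T : measurableType d).

Lemma measurable_ltr_set (f g : T -> R) :
  measurable_fun setT f -> measurable_fun setT g -> measurable [set w | f w < g w].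
Proof.
move=> mf mg; have := measurable_fun_ltr mf mg measurableT (Y := [set true]) I.
by rewrite setTI; congr measurable; apply/seteqP; split => w /=.
Qed.

Lemma measurable_ler_set (f g : T -> R) :
  measurable_fun setT f -> measurable_fun setT g -> measurable [set w | f w <= g w].
Proof.
move=> mf mg; have := measurable_fun_ler mf mg measurableT (Y := [set true]) I.
by rewrite setTI; congr measurable; apply/seteqP; split => w /=.
Qed.

Lemma measurable_psum (X : nat -> T -> R) n :
  (forall i, measurable_fun setT (X i)) ->
  measurable_fun setT (fun w => \sum_(i < n) X i w).
Proof. by move=> mX; apply: measurable_sum => i; exact: mX. Qed.

End Measurability.

(** * Upper tails of sums under upper orthant dependence *)

Section UpperOrthantSums.
Context (R : realType) (d : measure_display) (T : measurableType d).
Variables (P : probability T R) (Y : nat -> {RV P >-> R}).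
Variables (Gbar : R -> R) (M mu : R).
Hypothesis Y_law : forall i t, fine (P [set w | t < Y i w]) = Gbar t.
Hypothesis Y_ge0 : {ae P, forall w, forall i, 0 <= Y i w}.
Hypothesis M_gt0 : 0 < M.
Hypothesis Y_UOD : forall n (x : nat -> R), (1 <= n)%N ->
  fine (P (\bigcap_(i < n) [set w | x i < Y i w])) <=
    M * \prod_(i < n) fine (P [set w | x i < Y i w]).
Hypothesis Gbar_mean : forall (h : R) m, 0 <= h -> h * \sum_(k < m) Gbar (k.+1%:R * h) <= mu.

Let mY i : measurable_fun setT (Y i). Proof. exact: measurable_funPT. Qed.

Let mS n : measurable_fun setT (fun w => \sum_(i < n) Y i w).
Proof. exact: (measurable_psum (X := fun i => Y i)). Qed.

Let Gbar_ge0 t : 0 <= Gbar t. Proof. by rewrite -(Y_law 0) fine_prob_ge0. Qed.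

Let Gbar_le1 t : Gbar t <= 1.
Proof. by rewrite -(Y_law 0) fine_prob_le1//; exact: measurable_ltr_set. Qed.

(** A Chernoff bound in which exp is replaced by the affine factors 1 + w * W_i,
where W_i = (1/n) * #{1 <= k <= n : Y_i > k * y / n} lies within 1/n of Y_i / y.
Over n claims the discretization errors add up to 1, so S_n > (r+1) * y forces
W_1 + ... + W_n >= r, while E W_i <= mu / y. *)
Lemma truncated_sum_bound n r (x y w : R) : (0 < n)%N -> 0 <= w -> 0 < y ->
  r.+1%:R * y <= x ->
  (1 + w) ^+ r *
    fine (P [set v | x < \sum_(i < n) Y i v /\ forall i, (i < n)%N -> Y i v <= y])
  <= M * (1 + w * mu / y) ^+ n.
Proof.
move=> n0 w0 y0 ryx.
have nR : 0 < n%:R :> R by rewrite ltr0n.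
pose h := y / n%:R.
have h0 : 0 < h by rewrite divr_gt0.
have hn : n%:R * h = y by rewrite /h mulrC divfK// gt_eqF.
(* Threshold -1 with weight 1 produces the constant 1 in 1 + w * W_i. *)
pose thr k : R := if k is k'.+1 then k'.+1%:R * h else -1.
pose a (k : 'I_n.+1) : R := if val k is _.+1 then w / n%:R else 1.
pose E i (k : 'I_n.+1) := [set v | thr k < Y i v].
have mA : measurable
    [set v | x < \sum_(i < n) Y i v /\ forall i, (i < n)%N -> Y i v <= y].
  rewrite (_ : mkset _ = [set v | x < \sum_(i < n) Y i v] `&`
      \bigcap_(i in `I_n) [set v | Y i v <= y]); last by apply/seteqP; split.
  apply: measurableI; first exact: measurable_ltr_set.
  by apply: bigcap_measurableType => i _; exact: measurable_ler_set.
have a0 k : 0 <= a k by case: k => -[|k] ?; rewrite /a//= divr_ge0// ltW.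
have mE i k : measurable (E i k) by exact: measurable_ltr_set.
have w1 : 0 <= (1 + w) ^+ r by rewrite exprn_ge0// addr_ge0.
apply: (le_trans (orthant_prod_bound (M := M) w1 a0 mE mA _ _)).
- by move=> k; exact: (@Y_UOD n (fun i => thr (k i))).
- apply: filterS Y_ge0 => v Yv [xv yv].
  pose W i : R := \sum_(k < n) ((k.+1%:R * h < Y i v)%R)%:R / n%:R.
  have -> : \prod_(i < n) \sum_k a k * \1_(E i k) v = \prod_(i < n) (1 + w * W i).
    apply: eq_bigr => i _; rewrite big_ord_recl /= indicE mem_set /=; last first.
      by rewrite /E/= (lt_le_trans _ (Yv i)).
    congr (_ + _); first by rewrite /a/= mul1r.
    rewrite /W mulr_sumr; apply: eq_bigr => k _.
    rewrite /a /= [RHS]mulrCA mulrC; congr (_ * _).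
    by rewrite indicE /E /=; congr ((_ : bool)%:R); apply/idP/idP => [/set_mem|/mem_set].
  apply: bernoulli_prod => //.
    move=> i; rewrite /W -mulr_suml; apply/andP; split.
      by apply: divr_ge0; [exact: sumr_ge0|exact: ltW].
    rewrite ler_pdivrMr// mul1r -[X in _ <= X%:R](card_ord n) -sumr_const.
    by apply: ler_sum => k _; case: ltP.
  rewrite -(@ler_pM2r _ y)//; apply: (@le_trans _ _ (x - y)).
    by rewrite lerBrDr; move: ryx; rewrite -natr1 mulrDl mul1r.
  rewrite lerBlDr (le_trans (ltW xv))//.
  apply: (@le_trans _ _ (\sum_(i < n) (h + W i * y))).
    apply: ler_sum => i _; apply: (le_trans (sum_steps_ge (m := n) (ltW h0) _)).
      by rewrite hn yv.
    have -> : W i * y = h * \sum_(k < n) ((k.+1%:R * h < Y i v)%R)%:R.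
      by rewrite /W -mulr_suml [RHS]mulrC [RHS]mulrA [LHS]mulrAC.
    by rewrite lerD2l.
  by rewrite big_split/= sumr_const card_ord -[h *+ n]mulr_natl hn -mulr_suml addrC.
- rewrite ler_pM2l// -[X in _ <= _ ^+ X](card_ord n) -prodr_const.
  apply: ler_prod => i _; apply/andP; split.
    by apply: sumr_ge0 => k _; rewrite mulr_ge0// fine_prob_ge0.
  rewrite big_ord_recl /a /= mul1r Y_law lerD//.
  under eq_bigr do rewrite /E Y_law.
  rewrite -mulr_sumr.
  have -> : w / n%:R * \sum_(k < n) Gbar (k.+1%:R * h) =
      w * (h * \sum_(k < n) Gbar (k.+1%:R * h)) / y.
    by rewrite [in RHS]/h; field; rewrite !gt_eqF.
  by rewrite ler_wpM2r ?invr_ge0 ?(ltW y0)// ler_wpM2l// Gbar_mean// ltW.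
Qed.

(** Either some claim exceeds y = x / (r+1), or the truncated bound applies. *)
Lemma large_sum_bound n r (x : R) : (0 < n)%N -> 0 < x -> 0 < mu ->
  fine (P [set w | x < \sum_(i < n) Y i w]) <=
    n%:R * Gbar (x / r.+1%:R) + M * expR 1 * (mu * r.+1%:R * (n%:R / x)) ^+ r.
Proof.
move=> n0 x0 mu0.
have nR : 0 < n%:R :> R by rewrite ltr0n.
set y := x / r.+1%:R.
have y0 : 0 < y by rewrite divr_gt0.
pose A := [set v | x < \sum_(i < n) Y i v /\ forall i, (i < n)%N -> Y i v <= y].
have mA : measurable A.
  rewrite (_ : A = [set v | x < \sum_(i < n) Y i v] `&`
      \bigcap_(i in `I_n) [set v | Y i v <= y]); last by apply/seteqP; split.
  apply: measurableI; first exact: measurable_ltr_set.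
  by apply: bigcap_measurableType => i _; exact: measurable_ler_set.
have : fine (P [set w | x < \sum_(i < n) Y i w]) <=
    fine (P A) + \sum_(i < n) fine (P [set w | y < Y i w]).
  apply: (union_bound_ae (C := fun i => [set w | y < Y i w])) => //.
  - by move=> i; exact: measurable_ltr_set.
  - exact: measurable_ltr_set.
  apply: nearW => w xw; have [|h] := pselect (exists2 i, (i < n)%N & y < Y i w).
    by right.
  left; split => // i i_n; rewrite leNgt; apply/negP => yi; apply: h.
  by exists i.
move=> /le_trans; apply; rewrite addrC; apply: lerD.
  under eq_bigr do rewrite Y_law.
  by rewrite sumr_const card_ord mulr_natl.
(* This w makes w * mu / y = 1/n, so that the product stays below e. *)
pose w := y / (n%:R * mu).
have w0 : 0 < w by rewrite divr_gt0// mulr_gt0.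
have := @truncated_sum_bound n r x y w n0 (ltW w0) y0.
rewrite /y mulrC divfK ?gt_eqF// => /(_ (lexx _)) trunc.
have e1 : (1 + w * mu / y) ^+ n <= expR 1.
  have -> : w * mu / y = n%:R^-1 by rewrite /w; field; rewrite !gt_eqF.
  rewrite -[X in expR X](mulfV (lt0r_neq0 nR)) expRM_natl.
  by rewrite lerXn2r ?expR_ge1Dx ?nnegrE ?expR_ge0 ?addr_ge0 ?invr_ge0.
have w1 : 0 < (1 + w) ^+ r by rewrite exprn_gt0// addr_gt0.
rewrite -(ler_pM2l w1) (le_trans trunc)//.
set q := mu * r.+1%:R * (n%:R / x).
have q0 : 0 < q by rewrite !mulr_gt0// invr_gt0.
have wq : 1 <= ((1 + w) * q) ^+ r.
  apply: exprn_ege1; rewrite mulrDl mul1r.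
  have -> : w * q = 1 by rewrite /w /y /q; field; rewrite !gt_eqF.
  by rewrite lerDr ltW.
rewrite mulrCA -exprMn; apply: (@le_trans _ _ (M * expR 1)).
  by rewrite ler_pM2l.
by rewrite -[leLHS]mulr1 ler_pM2l// mulr_gt0// expR_gt0.
Qed.

(** Upper orthant dependence is stated for initial segments; the threshold -1
switches off the other coordinates. *)
Lemma pair_prob i j (s : R) : (i < j)%N ->
  fine (P ([set w | s < Y i w] `&` [set w | s < Y j w])) <= M * Gbar s ^+ 2.
Proof.
move=> ij.
pose x k : R := if (k == i) || (k == j) then s else -1.
have mC k : measurable [set w | x k < Y k w] by exact: measurable_ltr_set.
apply: (@le_trans _ _ (fine (P (\bigcap_(k < j.+1) [set w | x k < Y k w])))).
  apply: le_fine_prob_ae.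
  - by apply: measurableI; exact: measurable_ltr_set.
  - by apply: bigcap_measurableType => k _.
  apply: filterS Y_ge0 => w Yw [/= si sj] k /= _.
  rewrite /x; case: eqP => [->//|_]; case: eqP => [->//|_] /=.
  by rewrite (lt_le_trans _ (Yw k)).
apply: (le_trans (Y_UOD x _)) => //; rewrite ler_pM2l//.
under eq_bigr do rewrite Y_law.
rewrite (bigD1 (Ordinal (ltnSn j)))//= (bigD1 (Ordinal (ltnW ij : (i < j.+1)%N)))//=; last first.
  by rewrite -val_eqE/= ltn_eqF.
rewrite mulrA -[leRHS]mulr1 ler_pM ?mulr_ge0 ?prodr_ge0//.
  by rewrite /x !eqxx orbT.
by apply: prodr_ile1 => k _; rewrite Gbar_ge0 Gbar_le1.
Qed.

Lemma measurable_pairs n (s : R) : measurable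
  [set w | exists i j, [/\ (i < j < n)%N, s < Y i w & s < Y j w]].
Proof.
rewrite (_ : mkset _ = \bigcup_i \bigcup_j (if (i < j < n)%N then
    [set w | s < Y i w] `&` [set w | s < Y j w] else set0)); last first.
  apply/seteqP; split => [w [i [j [ij si sj]]]|w [i _ [j _]]].
    by exists i => //; exists j => //; rewrite ij.
  by case: ifP => // ij [si sj]; exists i, j.
apply: bigcupT_measurable => i; apply: bigcupT_measurable => j.
by case: ifP => // _; apply: measurableI; exact: measurable_ltr_set.
Qed.

Lemma pairs_bound n (s : R) :
  fine (P [set w | exists i j, [/\ (i < j < n)%N, s < Y i w & s < Y j w]]) <=
    (n * n)%:R * (M * Gbar s ^+ 2).
Proof.
pose C (p : 'I_n * 'I_n) := if (p.1 < p.2)%N then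
  [set w | s < Y p.1 w] `&` [set w | s < Y p.2 w] else set0.
have mC p : measurable (C p).
  rewrite /C; case: ifP => // _.
  by apply: measurableI; exact: measurable_ltr_set.
pose A := [set w | exists i j, [/\ (i < j < n)%N, s < Y i w & s < Y j w]].
have mA : measurable A := measurable_pairs n s.
have := @weighted_union_bound _ _ _ P _ (fun=> 1) C A 1 ler01 (fun=> ler01) mC mA.
rewrite mul1r => H; apply: le_trans (H _) _.
  apply: nearW => w [i [j [/andP[ij jn] si sj]]].
  rewrite (bigD1 (Ordinal (ltn_trans ij jn), Ordinal jn))//= mul1r indicE mem_set.
    by rewrite lerDl sumr_ge0.
  by rewrite /C/= ij.
rewrite -[X in (X * X)%:R](card_ord n) -card_prod mulr_natl -sumr_const.
apply: ler_sum => p _; rewrite mul1r /C; case: ifP => [pp|_].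
  exact: pair_prob.
by rewrite measure0; apply: mulr_ge0; [exact: ltW|exact: exprn_ge0].
Qed.

(** If no claim exceeds (1 - eps) * x and at most one exceeds eps * x / n, then the
sum is at most (1 - eps) * x + eps * x = x. *)
Lemma fixed_sum_bound n (eps x : R) : 0 < x -> 0 < eps < 1 ->
  fine (P [set w | x < \sum_(i < n) Y i w]) <=
    n%:R * Gbar ((1 - eps) * x) + (n * n)%:R * (M * Gbar (eps * x / n%:R) ^+ 2).
Proof.
move=> x0 /andP[e0 e1]; have [->|n0] := eqVneq n 0%N.
  rewrite (_ : [set w | _] = set0) ?measure0/= ?mul0r ?addr0//.
  by apply/seteqP; split => w //=; rewrite big_ord0 ltNge ltW.
have nR : 0 < n%:R :> R by rewrite ltr0n lt0n.
set s := eps * x / n%:R; set y := (1 - eps) * x.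
have s0 : 0 <= s by rewrite divr_ge0// mulr_ge0// ltW.
apply: le_trans (lerD (lexx _) (pairs_bound n s)).
rewrite addrC; have -> : n%:R * Gbar y = \sum_(i < n) fine (P [set w | y < Y i w]).
  under eq_bigr do rewrite Y_law.
  by rewrite sumr_const card_ord mulr_natl.
apply: (union_bound_ae (C := fun i => [set w | y < Y i w])) => //.
- by move=> i; exact: measurable_ltr_set.
- exact: measurable_ltr_set.
- exact: measurable_pairs.
apply: nearW => w xw; have [|h] := pselect (exists2 i, (i < n)%N & y < Y i w).
  by right.
left; apply: contrapT => noP; move: xw; rewrite /= ltNge => /negP; apply.
have yi i : (i < n)%N -> Y i w <= y.
  by move=> i_n; rewrite leNgt; apply/negP => yi; apply: h; exists i.
have ys : n%:R * s + y = x by rewrite /s /y; field; rewrite gt_eqF.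
have [[i0 i0n si0]|no] := pselect (exists2 i, (i < n)%N & s < Y i w); last first.
  rewrite -ys -[leLHS]addr0 lerD//; last by rewrite mulr_ge0 ?subr_ge0// ltW.
  rewrite mulr_natl -[X in _ <= _ *+ X](card_ord n) -sumr_const.
  by apply: ler_sum => i _; rewrite leNgt; apply/negP => si; apply: no; exists i.
rewrite (bigD1 (Ordinal i0n))//= -ys addrC lerD ?yi//.
rewrite mulr_natl -[X in _ <= _ *+ X](card_ord n) -sumr_const.
rewrite [leRHS](bigD1 (Ordinal i0n))//= -[leLHS]add0r lerD//.
apply: ler_sum => i ii0; rewrite leNgt; apply/negP => si; apply: noP.
have : (i != i0 :> nat) by [].
rewrite neq_ltn => /orP[ii|ii]; first by exists i, i0; rewrite ii i0n.
by exists i0, i; rewrite ii/= ltn_ord.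
Qed.

End UpperOrthantSums.

(** * Lower tails of sums under lower orthant dependence *)

Section LowerOrthantSums.
Context (R : realType) (d : measure_display) (T : measurableType d).
Variables (P : probability T R) (Z : nat -> {RV P >-> R}).
Variables (gL : nat -> R) (b delta : R).
Hypothesis Z_ge0 : {ae P, forall w, forall i, 0 <= Z i w}.
Hypothesis Z_LOD : forall n (x : nat -> R), (1 <= n)%N ->
  fine (P (\bigcap_(i < n) [set w | Z i w <= x i])) <=
    gL n * \prod_(i < n) fine (P [set w | Z i w <= x i]).
Hypothesis gL_gt0 : forall n, (1 <= n)%N -> 0 < gL n.
Hypothesis b_gt0 : 0 < b.
Hypothesis Z_law : forall i, fine (P [set w | Z i w <= b]) <= 1 - delta.

Let mZ i : measurable_fun setT (Z i). Proof. exact: measurable_funPT. Qed.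

(** If the sum is at most s = n * b * delta / 4, then each Z_i is at most s, and the
factor (1_{Z_i <= b} + 1_{Z_i <= s}) / 2 is 1 when Z_i <= b and 1/2 otherwise, so
it is at least exp (- Z_i / b). The product of the factors is thus at least
exp (- s / b), whereas each factor has mean at most 1 - delta / 2. *)
Lemma small_sum_bound n : (0 < n)%N ->
  fine (P [set w | \sum_(i < n) Z i w <= n%:R * (b * delta / 4)]) <=
    gL n * expR (- (delta / 4)) ^+ n.
Proof.
move=> n0.
set s := n%:R * _.
pose x (k : 'I_2) : R := if val k is 0%N then b else s.
pose E i (k : 'I_2) := [set w | Z i w <= x k].
have mE i k : measurable (E i k) by exact: measurable_ler_set.
have mA : measurable [set w | \sum_(i < n) Z i w <= s].
  by apply: measurable_ler_set => //; exact: (measurable_psum (X := fun i => Z i)).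
rewrite -(ler_pM2l (expR_gt0 (- (s / b)))).
have h2 : forall k : 'I_2, 0 <= 2^-1 :> R by move=> _; rewrite invr_ge0.
have eh : expR (- 1) <= 2^-1 :> R.
  by rewrite expRN lef_pV2 ?posrE ?expR_gt0//; have := expR_ge1Dx (1 : R).
apply: le_trans (@orthant_prod_bound _ _ _ P n 1 (gL n) _ (fun=> 2^-1) E _ (expR_ge0 _)
   h2 mE mA (fun k => @Z_LOD n (fun i => x (k i)) n0) _) _.
- apply: filterS Z_ge0 => w Zw /= Ss.
  apply: (@le_trans _ _ (expR (\sum_(i < n) - (Z i w / b)))).
    by rewrite ler_expR sumrN -mulr_suml lerN2 ler_pM2r ?invr_gt0.
  rewrite expR_sum; apply: ler_prod => i _; rewrite expR_ge0/=.
  rewrite big_ord_recl big_ord1 -mulrDr.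
  have -> : \1_(E i (lift ord0 ord0)) w = 1 :> R.
    rewrite indicE mem_set//= /E/=; apply: le_trans Ss.
    by rewrite (bigD1 i)//= lerDl sumr_ge0.
  have [Zb|Zb] := leP (Z i w) b.
    rewrite indicE mem_set// (_ : 2^-1 * (1 + 1) = 1); last by field.
    by rewrite -[leRHS]expR0 ler_expR oppr_le0 divr_ge0// ltW.
  rewrite indicE memNset ?add0r ?mulr1.
    apply: le_trans eh; rewrite ler_expR lerN2 ler_pdivlMr// mul1r ltW//.
  by rewrite /E/=; apply/negP; rewrite -ltNge.
have -> : expR (- (s / b)) = expR (- (delta / 4)) ^+ n.
  by rewrite -expRM_natl /s; congr expR; field; rewrite gt_eqF.
rewrite mulrCA -exprMn ler_pM2l ?gL_gt0// -expRD.
rewrite -[X in _ <= _ ^+ X](card_ord n) -prodr_const.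
apply: ler_prod => i _; apply/andP; split.
  by apply: sumr_ge0 => k _; rewrite mulr_ge0// fine_prob_ge0.
rewrite big_ord_recl big_ord1 -mulrDr.
(* Each factor has mean at most 1 - delta / 2 <= exp (- delta / 2). *)
have aux (p q e : R) : p <= 1 - delta -> q <= 1 ->
    1 + (- (delta / 4) - delta / 4) <= e -> 2^-1 * (p + q) <= e by clear h2; lra.
by apply: aux; [exact: Z_law|exact: fine_prob_le1|exact: expR_ge1Dx].
Qed.

End LowerOrthantSums.

(** * Tails of distributions on the half-line *)

Section TailOfDistribution.
Context (R : realType).
Variable F : probability (measurableTypeR R) R.

Lemma tailE x : tail F x = fine (F `]x, +oo[%classic).
Proof.
by rewrite /tail -setCitvr fine_probC// subKr.
Qed.

Lemma tail_ge0 x : 0 <= tail F x.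
Proof. by rewrite tailE fine_prob_ge0. Qed.

Lemma tail_nonincreasing x z : x <= z -> tail F z <= tail F x.
Proof.
move=> xz; rewrite !tailE; apply: le_fine_prob_ae => //.
by apply: nearW => w /=; rewrite !in_itv/= !andbT; exact: le_lt_trans.
Qed.

Lemma tail_rv d (T : measurableType d) (P : probability T R) (X : nat -> {RV P >-> R}) :
  identically_distributed X F ->
  forall i t, fine (P [set w | t < X i w]) = tail F t.
Proof.
move=> XF i t; rewrite tailE -(XF i)//; congr (fine (P _)).
by apply/seteqP; split => w /=; rewrite in_itv/= andbT.
Qed.

Lemma rv_ge0_ae d (T : measurableType d) (P : probability T R) (X : nat -> {RV P >-> R}) :
  identically_distributed X F -> supported_nneg F ->
  {ae P, forall w, forall i, 0 <= X i w}.
Proof.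
move=> XF F0; apply/ae_foralln => i.
have mA : measurable (X i @^-1` `[0, +oo[).
  by rewrite -[X in measurable X]setTI; exact: (measurable_funPT (X i)).
have PA : P (X i @^-1` `[0, +oo[) = 1%E.
  have : distribution P (X i) `[0, +oo[%classic = 1%E by rewrite XF.
  by [].
exists (~` (X i @^-1` `[0, +oo[)); split.
- exact: measurableC.
- by apply: etrans (probability_setC P mA) _; rewrite PA subee.
- by apply: subsetC => w /=; rewrite in_itv/= andbT.
Qed.

(** The strict positivity comes from the convention 0 / 0 = 0: where the tail
vanishes, the quotient in [tail_lower] is 0, which a limit 1 excludes. *)
Lemma consistently_varying_near : consistently_varying F ->
  forall eta : R, 0 < eta < 1 -> exists2 y, 1 < y &
  \forall x \near +oo%R, 0 < tail F x /\ (1 - eta) * tail F x <= tail F (x * y).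
Proof.
move=> Fcv eta /andP[eta0 eta1].
have B : nbhs (1 : \bar R)%E [set z | ((1 - eta)%:E < z)%E].
  apply: open_nbhs_nbhs; split; first exact: open_ereal_gt_ereal.
  by rewrite /= lte_fin; lra.
have [y [y1 ly]] : exists y, 1 < y /\ ((1 - eta)%:E < tail_lower F y)%E.
  have : \forall y \near 1^'+, 1 < y /\ ((1 - eta)%:E < tail_lower F y)%E.
    apply: filterI; first exact: nbhs_right_gt.
    exact: Fcv B.
  by move=> /filter_ex.
exists y => //; move: ly; rewrite /tail_lower limf_einfE.
move=> /ereal_sup_gt[_ [V Vinf <-]] Vlt.
apply: filterS Vinf => x Vx.
have : ((1 - eta)%:E < (tail F (x * y) / tail F x)%:E)%E.
  by apply: lt_le_trans Vlt _; apply: ereal_inf_lbound; exists x.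
rewrite lte_fin => h.
have Fx : 0 < tail F x.
  rewrite lt_neqAle tail_ge0 andbT; apply/eqP => F0.
  by move: h; rewrite -F0 invr0 mulr0; lra.
by split => //; move: h; rewrite ltr_pdivlMr// => /ltW.
Qed.

Lemma consistently_varying_gt0 : consistently_varying F -> forall x, 0 < tail F x.
Proof.
move=> /consistently_varying_near h x.
have [|y y1 xy] := h 2^-1; first by lra.
have : \forall z \near +oo%R, x <= z /\
    (0 < tail F z /\ (1 - 2^-1) * tail F z <= tail F (z * y)).
  by apply: filterI; [exact: nbhs_pinfty_ge (num_real x)|exact: xy].
move=> /filter_ex[z [xz [Fz _]]].
exact: lt_le_trans Fz (tail_nonincreasing xz).
Qed.

Let mE : measurable_fun [set: R] (fun x : R => x%:E). Proof. exact: EFin_measurable. Qed.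

Lemma supported_nneg_ae : supported_nneg F -> {ae F, forall x : R, 0 <= x}.
Proof.
move=> F0; have mA : measurable (`[0, +oo[%classic : set R) by [].
exists (~` `[0, +oo[%classic); split.
- exact: measurableC.
- by apply: etrans (probability_setC F mA) _; rewrite F0 subee.
- by apply: subsetC => w /=; rewrite in_itv/= andbT.
Qed.

Lemma mean_max0 : supported_nneg F -> mean F = (\int[F]_x (Num.max x 0)%:E)%E.
Proof.
move=> F0; rewrite /mean; apply: ae_eq_integral => //.
- by apply/measurable_EFinP; apply: measurable_maxr.
apply: ae_imply (supported_nneg_ae F0) => x x0 _ /=.
by rewrite max_l.
Qed.

(** A lower Riemann sum of the tail, bounded by the mean because the step function
h * #{k : k * h < x} stays below x. *)
Lemma tail_sum_le_mean : supported_nneg F -> (mean F < +oo)%E ->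
  forall (h : R) m, 0 <= h -> h * \sum_(k < m) tail F (k.+1%:R * h) <= fine (mean F).
Proof.
move=> F0 Foo h m h0.
pose C (k : 'I_m) : set R := `]k.+1%:R * h, +oo[%classic.
have mC k : measurable (C k) by exact: measurable_itv.
have mean0 : (0 <= mean F)%E.
  by rewrite mean_max0//; apply: integral_ge0 => x _; rewrite lee_fin le_max lexx orbT.
rewrite -lee_fin fineK ?ge0_fin_numE// mean_max0//.
rewrite mulr_sumr; under eq_bigr do rewrite tailE.
rewrite -(integral_weighted_indic F (c := fun=> h) (C := C))//.
apply: ge0_le_integral => //.
- by move=> x _; rewrite lee_fin sumr_ge0// => i _; rewrite mulr_ge0.
- by apply/measurable_EFinP; exact: measurable_weighted_indic.
- by apply/measurable_EFinP; exact: measurable_maxr.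
move=> x _; rewrite lee_fin -mulr_sumr.
rewrite (eq_bigr (fun k : 'I_m => ((k.+1%:R * h < x)%R)%:R)); last first.
  move=> k _; rewrite indicE; congr ((_ : bool)%:R).
  by apply/idP/idP => [/set_mem|kx]; [|apply/mem_set]; rewrite /C/= in_itv/= andbT.
have [x0|x0] := leP 0 x; first exact: sum_steps_le.
rewrite big1 ?mulr0// => k _.
by rewrite ltNge (le_trans (ltW x0))// mulr_ge0.
Qed.

Lemma mean_gt0_tail_gt0 : supported_nneg F -> (0 < mean F)%E ->
  exists2 b : R, 0 < b & 0 < tail F b.
Proof.
move=> F0 mean0; apply: contrapT => nex.
have tail0 (b : R) : 0 < b -> F `]b, +oo[%classic = 0%E.
  move=> b0; rewrite -[LHS]fine_probK//; congr (_%:E); rewrite -tailE.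
  apply/eqP; rewrite eq_le tail_ge0 andbT leNgt; apply/negP => tb.
  by apply: nex; exists b.
have ae0 : {ae F, forall x : R, forall k : nat, x <= k.+1%:R^-1}.
  apply/ae_foralln => k; exists (`]k.+1%:R^-1, +oo[%classic); split => //.
    by apply: tail0; rewrite invr_gt0.
  by move=> x /= /negP; rewrite -ltNge in_itv/= andbT.
move: mean0; rewrite mean_max0// (_ : (\int[F]_x _ = 0)%E) ?ltxx//.
rewrite (ae_eq_integral (fun=> 0%E)) ?integral0//.
  by apply/measurable_EFinP; exact: measurable_maxr.
apply: ae_imply ae0 => x xk _; congr (_%:E); apply: max_r.
rewrite leNgt; apply/negP => x0.
have /= := xk (Num.truncn x^-1); rewrite leNgt => /negP; apply.
by rewrite invf_plt ?posrE//; apply: truncnS_gt.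
Qed.

End TailOfDistribution.

(** * Regularity of consistently varying tails *)

Section ConsistentTails.
Context (R : realType).
Variables (Gbar : R -> R) (mu : R).
Hypothesis Gbar_gt0 : forall x, 0 < Gbar x.
Hypothesis Gbar_nincr : forall x z, x <= z -> Gbar z <= Gbar x.
Hypothesis Gbar_cv : forall eta : R, 0 < eta < 1 -> exists2 y, 1 < y &
  \forall x \near +oo%R, (1 - eta) * Gbar x <= Gbar (x * y).
Hypothesis Gbar_mean : forall (h : R) m, 0 <= h -> h * \sum_(k < m) Gbar (k.+1%:R * h) <= mu.

Lemma bernoulli_expr n (y : R) : 1 <= y -> 1 + n%:R * (y - 1) <= y ^+ n.
Proof.
move=> y1; elim: n => [|n IH]; first by rewrite mul0r addr0 expr0.
rewrite exprS; apply: le_trans (ler_wpM2l _ IH); last exact: le_trans y1.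
have : 0 <= n%:R * ((y - 1) * (y - 1)) by rewrite !mulr_ge0 ?subr_ge0.
by rewrite -natr1; lra.
Qed.

(** Consistent variation gives y > 1 with Gbar x <= 2 * Gbar (x * y) beyond x0.
Iterating k times, with x * y ^ k the first point of this form past z, costs 2 ^ k, which
is polynomial in z / x because k is logarithmic in z / x. *)
Lemma potter : exists (x0 C : R) (p : nat), [/\ 0 < x0, 0 < C &
  forall x z, x0 <= x -> x <= z -> Gbar x <= C * (z / x) ^+ p * Gbar z].
Proof.
have [|y y1 [A [_ hA]]] := Gbar_cv (eta := 2^-1); first by lra.
pose x0 := Num.max 1 (A + 1).
have x0A x : x0 <= x -> 2^-1 * Gbar x <= Gbar (x * y).
  move=> xx; have := hA x; rewrite (_ : 1 - 2^-1 = 2^-1); last by field.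
  by apply; rewrite (lt_le_trans _ xx)// lt_max ltrDl ltr01 orbT.
have x01 : 1 <= x0 by rewrite le_max lexx.
have y0 : 0 < y by rewrite (lt_trans _ y1).
have iter k x : x0 <= x -> Gbar x <= 2 ^+ k * Gbar (x * y ^+ k).
  move=> xx; elim: k => [|k IH]; first by rewrite !expr0 mul1r mulr1.
  apply: (le_trans IH); rewrite exprSr -mulrA ler_wpM2l ?exprn_ge0//.
  have := x0A (x * y ^+ k); rewrite [y ^+ k.+1]exprSr mulrA => h.
  rewrite -(@ler_pM2l _ 2^-1) ?invr_gt0// mulrA mulVf// mul1r h//.
  by rewrite (le_trans xx)// ler_peMr ?exprn_ege1 ?(le_trans _ xx) ?(le_trans _ x01)// ltW.
have pow_unbounded (u : R) : 0 <= u -> exists k, u <= y ^+ k.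
  have t0 : 0 < y - 1 by rewrite subr_gt0.
  move=> u0; exists (Num.truncn (u / (y - 1))).+1.
  apply: (le_trans _ (bernoulli_expr _ (ltW y1))).
  apply: (@le_trans _ _ ((Num.truncn (u / (y - 1))).+1%:R * (y - 1))).
    by rewrite -ler_pdivrMr// ltW// truncnS_gt.
  by rewrite lerDr.
have [p yp] := pow_unbounded 2 (ler0n _ 2).
exists x0, (y ^+ p), p; split; rewrite ?exprn_gt0 ?(lt_le_trans _ x01)//.
move=> x z xx xz.
have x_gt0 : 0 < x by rewrite (lt_le_trans _ xx)// (lt_le_trans _ x01).
have [k zk] : exists k, z <= x * y ^+ k.
  have [|k hk] := pow_unbounded (z / x); first by rewrite divr_ge0 ?(le_trans _ xz)// ltW.
  by exists k; rewrite mulrC -ler_pdivrMr.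
(* The least k with z <= x * y ^ k satisfies y ^ (k-1) < z / x. *)
case: (ex_minnP (ex_intro (fun k => z <= x * y ^+ k) k zk)) => {zk}k zk kmin.
have yk : y ^+ k <= y * (z / x).
  case: k zk kmin => [|k] zk kmin.
    by rewrite expr0 mulr_ege1 ?(ltW y1)// ler_pdivlMr// mul1r.
  rewrite exprS ler_pM2l// ler_pdivlMr// mulrC leNgt; apply/negP => /ltW /kmin.
  by rewrite ltnn.
apply: (le_trans (iter k x xx)).
have Gxk : Gbar (x * y ^+ k) <= Gbar z := Gbar_nincr zk.
apply: ler_pM => //; rewrite ?exprn_ge0 ?(ltW (Gbar_gt0 _))//.
rewrite -exprMn; apply: (@le_trans _ _ ((y ^+ p) ^+ k)).
  by rewrite lerXn2r ?nnegrE// exprn_ge0// ltW.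
rewrite -exprM mulnC exprM lerXn2r ?nnegrE ?exprn_ge0 ?mulr_ge0 ?divr_ge0// ltW//.
  by rewrite (lt_le_trans x_gt0).
by rewrite invr_gt0.
Qed.

Lemma Gbar_markov x : 0 < x -> Gbar x <= mu / x.
Proof.
move=> x0; have := Gbar_mean 1 (ltW x0); rewrite big_ord1 mul1r => h.
by rewrite ler_pdivlMr// mulrC.
Qed.

Lemma Gbar_small e : 0 < e -> \forall x \near +oo%R, Gbar x <= e.
Proof.
move=> e0; near=> x; have x0 : 0 < x by near: x; exact: nbhs_pinfty_gt.
apply: (le_trans (Gbar_markov x0)); rewrite ler_pdivrMr// mulrC -ler_pdivrMr//.
Unshelve. all: by end_near. Qed.

Lemma Gbar_scale (a : R) : 0 < a < 1 ->
  exists2 C, 0 < C & \forall x \near +oo%R, Gbar (a * x) <= C * Gbar x.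
Proof.
move=> /andP[a0 a1]; have [x0 [C [p [x0_gt0 C0 pot]]]] := potter.
exists (C * a^-1 ^+ p); first by rewrite mulr_gt0// exprn_gt0// invr_gt0.
near=> x; have x_gt0 : 0 < x by near: x; exact: nbhs_pinfty_gt.
have -> : a^-1 = x / (a * x) by field; rewrite !gt_eqF.
apply: pot; last by rewrite ler_piMl// ltW.
rewrite mulrC -ler_pdivrMr//.
Unshelve. all: by end_near. Qed.

(** The reformulation of consistent variation with the scaling factor y^-1 < 1. *)
Lemma Gbar_scale_sharp (eta : R) : 0 < eta -> exists2 eps, 0 < eps < 1 &
  \forall x \near +oo%R, Gbar ((1 - eps) * x) <= (1 + eta) * Gbar x.
Proof.
move=> eta0; pose e := eta / (1 + eta).
have eta1 : 0 < 1 + eta by lra.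
have e01 : 0 < e < 1 by rewrite divr_gt0//= ltr_pdivrMr// mul1r ltrDr.
have [y y1 [A [_ hA]]] := Gbar_cv e01.
have y0 : 0 < y by rewrite (lt_trans _ y1).
exists (1 - y^-1).
  by rewrite subr_gt0 invf_lt1// y1/= ltrBlDr ltrDl invr_gt0.
near=> x; rewrite subKr.
have := hA (y^-1 * x); rewrite mulrAC mulVf ?gt_eqF// mul1r => h.
have -> : Gbar (y^-1 * x) = (1 + eta) * ((1 - e) * Gbar (y^-1 * x)).
  by rewrite /e; field; rewrite gt_eqF.
rewrite ler_pM2l//; apply: h.
have xA : A * y < x by near: x; apply: nbhs_pinfty_gt; exact: num_real.
by rewrite mulrC ltr_pdivlMr.
Unshelve. all: by end_near. Qed.

(** A bounded shift is eventually smaller than any scaling by y > 1. *)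
Lemma Gbar_shift (a eta : R) : 0 < eta < 1 ->
  \forall x \near +oo%R, (1 - eta) * Gbar x <= Gbar (x + a).
Proof.
move=> e01; have [y y1 h] := Gbar_cv e01.
have y10 : 0 < y - 1 by rewrite subr_gt0.
near=> x; apply: (@le_trans _ _ (Gbar (x * y))); first by near: x.
apply: Gbar_nincr; rewrite -lerBrDl (_ : x * y - x = x * (y - 1)); last by ring.
rewrite -ler_pdivrMr//.
Unshelve. all: by end_near. Qed.

(** [potter] applied at x0 bounds Gbar from below by a multiple of x^-p. Both conclusions
are stated together because the same exponent p must serve in
[truncated_moment_small]. *)
Lemma potter_poly : exists (x0 C : R) (p : nat), [/\ 0 < x0, 0 < C,
  forall x z, x0 <= x -> x <= z -> Gbar x <= C * (z / x) ^+ p * Gbar z &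
  forall K e : R, 0 < K -> 0 < e -> \forall x \near +oo%R, K * x^-1 ^+ p.+1 <= e * Gbar x].
Proof.
have [x0 [C [p [x0_gt0 C0 pot]]]] := potter.
exists x0, C, p; split => //.
have Gx0 := Gbar_gt0 x0.
have c0 : 0 < Gbar x0 * x0 ^+ p / C by rewrite divr_gt0// mulr_gt0// exprn_gt0.
have hc x : x0 <= x -> Gbar x0 * x0 ^+ p / C * x^-1 ^+ p <= Gbar x.
  move=> xx0; have x_gt0 : 0 < x by rewrite (lt_le_trans x0_gt0).
  have := pot x0 x (lexx _) xx0; rewrite expr_div_n => h.
  rewrite exprVn ler_pdivrMr ?exprn_gt0// ler_pdivrMr// -ler_pdivlMr ?exprn_gt0//.
  apply: (le_trans h); rewrite le_eqVlt; apply/orP; left; apply/eqP.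
  by field; rewrite gt_eqF ?exprn_gt0.
move: (Gbar x0 * x0 ^+ p / C) c0 hc => c c0 hc.
move=> K e K0 e0; near=> x.
have xx0 : x0 <= x by near: x; apply: nbhs_pinfty_ge; exact: num_real.
have xK : K / (e * c) <= x by near: x; apply: nbhs_pinfty_ge; exact: num_real.
have x_gt0 : 0 < x by rewrite (lt_le_trans x0_gt0).
apply: (@le_trans _ _ (e * (c * x^-1 ^+ p))); last by rewrite ler_pM2l// hc.
rewrite exprS !mulrA ler_pM2r ?exprn_gt0 ?invr_gt0//.
by rewrite ler_pdivrMr// mulrC -ler_pdivrMr ?mulr_gt0.
Unshelve. all: by end_near. Qed.

End ConsistentTails.

(** * Summation by parts against powers *)

Section PowerSums.
Context (R : realType).

Lemma expr_succ_le p k : k.+1%:R ^+ p.+1 <= k%:R ^+ p.+1 + p.+1%:R * k.+1%:R ^+ p :> R.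
Proof.
elim: p => [|p IH]; first by rewrite !expr1 expr0 mulr1 natr1.
have b0 : 0 <= k.+1%:R :> R by [].
rewrite [leLHS]exprS; apply: (le_trans (ler_wpM2l b0 IH)).
rewrite mulrDr mulrCA -exprS -[in leLHS]natr1 mulrDl mul1r -exprS natr1.
rewrite -addrA lerD2l -[in leRHS]natr1 mulrDl mul1r addrC lerD2l.
by rewrite lerXn2r ?nnegrE// ler_nat.
Qed.

Lemma sum_le_prefix (a : nat -> R) (B : R) n2 K : (forall n, 0 <= a n) -> 0 <= B ->
  (forall n, (n2 <= n < K)%N -> a n <= B) ->
  \sum_(0 <= n < K) a n <= \sum_(0 <= n < n2) a n + K%:R * B.
Proof.
move=> a0 B0; elim: K => [|K IH] h.
  by rewrite big_geq// mul0r addr0 sumr_ge0.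
rewrite big_nat_recr//= -natr1 mulrDl mul1r addrA; have [Kn|nK] := ltnP K n2.
  rewrite -big_nat_recr//= (big_cat_nat _ Kn)//= -!addrA lerDl.
  by rewrite !addr_ge0 ?mulr_ge0// sumr_ge0.
apply: lerD; last by rewrite h// nK ltnS leqnn.
by apply: IH => n /andP[n1 n2']; rewrite h// n1 ltnW.
Qed.

End PowerSums.

Section Abel.
Context (R : realType).
Variables (q : nat -> R).
Hypothesis q_ge0 : forall n, 0 <= q n.

(** Summation by parts: the increments of k ^ (p+1) are at most (p+1) * k ^ p. With
q n = P(N >= n), the left-hand side is the truncated moment of N of order p + 1. *)
Lemma abel_power_sum p K :
  \sum_(0 <= n < K) (q n.+1 - q n.+2) * n.+1%:R ^+ p.+1 <=
  p.+1%:R * \sum_(0 <= n < K) n.+1%:R ^+ p * q n.+1.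
Proof.
(* The boundary term is carried along for the induction. *)
suff : \sum_(0 <= n < K) (q n.+1 - q n.+2) * n.+1%:R ^+ p.+1 + K%:R ^+ p.+1 * q K.+1 <=
    p.+1%:R * \sum_(0 <= n < K) n.+1%:R ^+ p * q n.+1.
  by apply: le_trans; rewrite lerDl mulr_ge0// exprn_ge0.
elim: K => [|K IH]; first by rewrite !big_geq// expr0n mul0r mulr0 addr0.
rewrite !big_nat_recr//= mulrDr; apply: le_trans (lerD IH (lexx _)).
rewrite -!addrA lerD2l.
rewrite (_ : _ + _ = K.+1%:R ^+ p.+1 * q K.+1); last by ring.
apply: (le_trans (ler_wpM2r (q_ge0 K.+1) (expr_succ_le R p K))).
by rewrite mulrDl mulrA.
Qed.

End Abel.

(** * Upper bound for the tail of a random sum *)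

Section RandomSumTail.
Context (R : realType).
Variables (Gbar : R -> R) (mu : R).
Hypothesis Gbar_gt0 : forall x, 0 < Gbar x.
Hypothesis Gbar_nincr : forall x z, x <= z -> Gbar z <= Gbar x.
Hypothesis Gbar_cv : forall eta : R, 0 < eta < 1 -> exists2 y, 1 < y &
  \forall x \near +oo%R, (1 - eta) * Gbar x <= Gbar (x * y).
Hypothesis Gbar_mean : forall (h : R) m, 0 <= h -> h * \sum_(k < m) Gbar (k.+1%:R * h) <= mu.

Variables (q : nat -> R) (E : R).
Hypothesis q_ge0 : forall n, 0 <= q n.
Hypothesis q_nincr : forall n, q n.+1 <= q n.
Hypothesis q_o : forall eta : R, 0 < eta ->
  exists n1, forall n, (n1 <= n)%N -> q n <= eta * Gbar n%:R.
Hypothesis q_sum : forall K, \sum_(0 <= n < K) q n.+1 <= E.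

(* s n x stands for P(S_n > x) and q n for P(N >= n). *)
Variables (s : nat -> R -> R) (M : R).
Hypothesis M_gt0 : 0 < M.
Hypothesis s_fixed : forall n (eps x : R), 0 < x -> 0 < eps < 1 ->
  s n x <= n%:R * Gbar ((1 - eps) * x) + (n * n)%:R * (M * Gbar (eps * x / n%:R) ^+ 2).
Hypothesis s_large : forall n r (x : R), (0 < n)%N -> 0 < x ->
  s n x <= n%:R * Gbar (x / r.+1%:R) + M * expR 1 * (mu * r.+1%:R * (n%:R / x)) ^+ r.

Let Gbar_ge0 x : 0 <= Gbar x. Proof. exact: ltW. Qed.

Let mu_ge0 : 0 <= mu.
Proof. by apply: le_trans (Gbar_mean 0 (lexx 0)); rewrite mul0r. Qed.

Lemma fixed_sum_near n (eta : R) : 0 < eta ->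
  \forall x \near +oo%R, s n x <= (n%:R + eta) * Gbar x.
Proof.
move=> eta0; have [->|n0] := eqVneq n 0%N.
  near=> x; have x0 : 0 < x by near: x; exact: nbhs_pinfty_gt.
  apply: (le_trans (s_fixed 0 (eps := 2^-1) x0 _)); first by lra.
  by rewrite !mul0r add0r mulr_ge0// addr_ge0// ltW.
have nR : 0 < n%:R :> R by rewrite ltr0n lt0n.
have [|eps eps01 hsharp] :=
  Gbar_scale_sharp Gbar_cv (eta := eta / 2 / n%:R); first by rewrite !divr_gt0.
have e01 : 0 < eps / n%:R < 1.
  case/andP: eps01 => e0 e1; rewrite divr_gt0//= ltr_pdivrMr// mul1r (lt_le_trans e1)//.
  by rewrite ler1n lt0n.
have [C C0 hscale] := Gbar_scale Gbar_gt0 Gbar_nincr Gbar_cv e01.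
have hsmall : \forall x \near +oo%R,
    Gbar x <= eta / 2 / ((n * n)%:R * M * C).
  by apply: (Gbar_small Gbar_mean); rewrite !divr_gt0// !mulr_gt0// natrM mulr_gt0.
case: hsmall => A [_ hsmall].
near=> x; have x0 : 0 < x by near: x; exact: nbhs_pinfty_gt.
have xA : A / (eps / n%:R) < x by near: x; apply: nbhs_pinfty_gt; exact: num_real.
apply: (le_trans (s_fixed n x0 eps01)).
have h1 : n%:R * Gbar ((1 - eps) * x) <= (n%:R + eta / 2) * Gbar x.
  apply: (@le_trans _ _ (n%:R * ((1 + eta / 2 / n%:R) * Gbar x))).
    by rewrite ler_pM2l//; near: x.
  by rewrite le_eqVlt; apply/orP; left; apply/eqP; field; rewrite gt_eqF.
have h2 : Gbar (eps / n%:R * x) <= C * Gbar x by near: x.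
have h3 : Gbar (eps / n%:R * x) <= eta / 2 / ((n * n)%:R * M * C).
  by apply: hsmall; rewrite mulrC -ltr_pdivrMr//; case/andP: e01.
have -> : (n%:R + eta) * Gbar x = (n%:R + eta / 2) * Gbar x + eta / 2 * Gbar x by field.
apply: lerD => //.
have -> : eps * x / n%:R = eps / n%:R * x by rewrite mulrAC.
have nM : 0 < (n * n)%:R * M * C by rewrite !mulr_gt0// natrM mulr_gt0.
have -> : eta / 2 * Gbar x = (n * n)%:R * (M * ((eta / 2 / ((n * n)%:R * M * C)) * (C * Gbar x))).
  by field; rewrite !gt_eqF.
rewrite ler_wpM2l// ler_pM2l// expr2; exact: ler_pM.
Unshelve. all: by end_near. Qed.

Lemma partial_sums_near n0 (eta : R) : 0 < eta ->
  \forall x \near +oo%R, forall n, (n < n0)%N -> s n.+1 x <= (n.+1%:R + eta) * Gbar x.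
Proof.
move=> eta0; elim: n0 => [|n0 IH]; first by near=> x.
have h := fixed_sum_near n0.+1 eta0.
near=> x => n; rewrite ltnS leq_eqVlt => /orP[/eqP->|nn].
  by near: x.
move: n nn; near: x; exact: IH.
Unshelve. all: by end_near. Qed.

(** [Gbar_scale] absorbs the scaling of the argument of Gbar into the constant. *)
Lemma large_sum_near r : exists2 C, 0 < C & \forall x \near +oo%R,
  forall n, (0 < n)%N -> s n x <= C * n%:R * Gbar x + C * (n%:R / x) ^+ r.
Proof.
have r01 : ((0 : R) < (r.+2%:R : R)^-1 < 1)%R.
  by apply/andP; split; rewrite ?invr_gt0 ?invf_lt1 ?ltr1n // ltr0n.
have [C C0 hscale] := Gbar_scale Gbar_gt0 Gbar_nincr Gbar_cv r01.
pose C1 := M * expR 1 * (mu * r.+1%:R) ^+ r.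
have C1_ge0 : 0 <= C1.
  by rewrite mulr_ge0 ?exprn_ge0 ?mulr_ge0 ?expR_ge0 ?(ltW M_gt0).
exists (C + C1); first by rewrite ltr_pwDl.
near=> x => n n0; have x0 : 0 < x by near: x; exact: nbhs_pinfty_gt.
apply: (le_trans (s_large r n0 x0)); apply: lerD.
  rewrite [leRHS]mulrAC [leLHS]mulrC ler_wpM2r//.
  apply: (@le_trans _ _ (Gbar (r.+2%:R^-1 * x))).
    by apply: Gbar_nincr; rewrite mulrC ler_pM2l// lef_pV2 ?posrE// ler_nat.
  apply: (@le_trans _ _ (C * Gbar x)); first by near: x.
  by rewrite ler_wpM2r// lerDl.
rewrite exprMn mulrA ler_wpM2r ?exprn_ge0 ?divr_ge0 ?(ltW x0)// lerDr ltW//.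
Unshelve. all: by end_near. Qed.

Let dlt n := q n.+1 - q n.+2.

Let dlt_ge0 n : 0 <= dlt n. Proof. by rewrite subr_ge0. Qed.

Let moment1 K : \sum_(0 <= n < K) dlt n * n.+1%:R <= E.
Proof.
have := abel_power_sum q_ge0 0 K; rewrite mul1r.
under [X in X <= _ -> _]eq_bigr do rewrite expr1.
under [X in _ <= X -> _]eq_bigr do rewrite expr0 mul1r.
by move=> /le_trans; apply.
Qed.

Let moment1_tail (delta : R) : 0 < delta -> exists n0, forall K, (n0 <= K)%N ->
  \sum_(n0 <= n < K) dlt n * n.+1%:R <= delta.
Proof.
move=> d0; pose S := range (fun K => \sum_(0 <= n < K) dlt n * n.+1%:R).
have hS : has_sup S.
  split; first by exists (\sum_(0 <= n < 0) dlt n * n.+1%:R); exists 0%N.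
  by exists E => _ [K _ <-]; exact: moment1.
have [_ [n0 _ <-] hn0] := sup_adherent d0 hS.
exists n0 => K n0K.
have : \sum_(0 <= n < K) dlt n * n.+1%:R <= sup S.
  by apply: ub_le_sup; [case: hS|exists K].
rewrite (big_cat_nat _ n0K)//=; move: hn0; lra.
Qed.

(** After summation by parts, the terms with large n are at most a small multiple of
n ^ p * Gbar n, and n ^ p * Gbar n <= C * x ^ p * Gbar x for n <= x by [potter]. There
are at most x of them. The finitely many remaining terms contribute
O(x ^ -(p+1)), which is o(Gbar x). *)
Lemma truncated_moment_small p (x0 C : R) : 0 < x0 -> 0 < C ->
  (forall x z, x0 <= x -> x <= z -> Gbar x <= C * (z / x) ^+ p * Gbar z) ->
  (forall K e : R, 0 < K -> 0 < e -> \forall x \near +oo%R, K * x^-1 ^+ p.+1 <= e * Gbar x) ->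
  forall eta, 0 < eta -> \forall x \near +oo%R, forall K, K%:R <= x ->
  \sum_(0 <= n < K) dlt n * (n.+1%:R / x) ^+ p.+1 <= eta * Gbar x.
Proof.
move=> x0_gt0 C0 pot poly eta eta0.
(* The weight e1 compensates for the factor p+1 of the summation by parts and
   for the Potter constant. *)
have [e1 e1_gt0 e1E] : exists2 e1, 0 < e1 & p.+1%:R * (e1 * C) = eta / 2.
  exists (eta / 2 / p.+1%:R / C); first by rewrite !divr_gt0.
  by field; rewrite gt_eqF//= nat1r pnatr_eq0.
have [n1 qn1] := q_o e1_gt0.
pose n2 := maxn n1 (Num.truncn x0).+1.
pose A := \sum_(0 <= n < n2) n.+1%:R ^+ p * q n.+1.
have A0 : 0 <= A by apply: sumr_ge0 => n _; rewrite mulr_ge0// exprn_ge0.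
have A1 : 0 < p.+1%:R * A + 1 by rewrite ltr_wpDl ?mulr_ge0.
have eta2 : 0 < eta / 2 by rewrite divr_gt0.
have polyA := poly _ _ A1 eta2.
near=> x => K Kx; have x_gt0 : 0 < x by near: x; exact: nbhs_pinfty_gt.
have hA : (p.+1%:R * A + 1) * x^-1 ^+ p.+1 <= eta / 2 * Gbar x by near: x.
have xp : 0 < x ^+ p.+1 by rewrite exprn_gt0.
have -> : \sum_(0 <= n < K) dlt n * (n.+1%:R / x) ^+ p.+1 =
    (\sum_(0 <= n < K) dlt n * n.+1%:R ^+ p.+1) * x^-1 ^+ p.+1.
  by rewrite mulr_suml; apply: eq_bigr => n _; rewrite exprMn mulrA.
apply: (@le_trans _ _ (p.+1%:R * (A + x * (e1 * C * x ^+ p * Gbar x)) * x^-1 ^+ p.+1)).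
  rewrite ler_wpM2r ?exprn_ge0 ?invr_ge0 ?(ltW x_gt0)//.
  apply: (le_trans (abel_power_sum q_ge0 p K)); rewrite ler_wpM2l//.
  have B0 : 0 <= e1 * C * x ^+ p * Gbar x by rewrite ltW// !mulr_gt0// exprn_gt0.
  apply: (le_trans (sum_le_prefix (B := e1 * C * x ^+ p * Gbar x) (n2 := n2) _ _ _)) => //.
  - by move=> n; rewrite mulr_ge0// exprn_ge0.
  - move=> n /andP[n2n nK].
    have nn1 : (n1 <= n.+1)%N by rewrite (leq_trans (leq_maxl _ _ : (n1 <= n2)%N))// ltnW.
    have nx0 : x0 <= n.+1%:R.
      rewrite ltW// (lt_le_trans (truncnS_gt x0))// ler_nat.
      by rewrite (leq_trans (leq_maxr n1 _)) // ltnW.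
    have nx : n.+1%:R <= x by rewrite (le_trans _ Kx)// ler_nat.
    apply: (@le_trans _ _ (n.+1%:R ^+ p * (e1 * (C * (x / n.+1%:R) ^+ p * Gbar x)))).
      rewrite ler_wpM2l ?exprn_ge0// (le_trans (qn1 _ nn1))// ler_wpM2l ?(ltW e1_gt0)//.
      exact: pot.
    rewrite le_eqVlt; apply/orP; left; apply/eqP; rewrite expr_div_n.
    by field; rewrite expf_eq0 pnatr_eq0 andbF.
  - by rewrite lerD2l ler_wpM2r.
have -> : eta * Gbar x = eta / 2 * Gbar x + eta / 2 * Gbar x by field.
rewrite mulrDr mulrDl; apply: lerD.
  by apply: le_trans hA; rewrite ler_wpM2r ?exprn_ge0 ?invr_ge0 ?(ltW x_gt0)// lerDl.
rewrite le_eqVlt; apply/orP; left; apply/eqP; rewrite exprVn exprS -e1E.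
by field; rewrite expf_eq0 !gt_eqF// andbF.
Unshelve. all: by end_near. Qed.

(** The left-hand side bounds P(S_N > x) by splitting on the value of N up to K and
counting the event N > K entirely. Up to a fixed n0 the asymptotics of each S_n are used; from n0
to K the uniform bound, whose two terms are controlled by the tail of the series
E N and by [truncated_moment_small]. *)
Lemma random_sum_tail (eta : R) : 0 < eta ->
  \forall x \near +oo%R, forall K, K = Num.truncn x ->
  q K.+1 + \sum_(0 <= n < K) (q n.+1 - q n.+2) * s n.+1 x <= (E + eta) * Gbar x.
Proof.
move=> eta0.
have E0 : 0 <= E by apply: le_trans (q_sum 0); rewrite big_geq.
have [x0 [C0 [p [x0_gt0 C0_gt0 pot poly]]]] := potter_poly Gbar_gt0 Gbar_nincr Gbar_cv.
have [C C_gt0 hlarge] := large_sum_near p.+1.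
pose e := eta / 4.
have e_gt0 : 0 < e by rewrite divr_gt0.
have [n0 hn0] := moment1_tail (divr_gt0 e_gt0 C_gt0).
have hpow := truncated_moment_small x0_gt0 C0_gt0 pot poly (divr_gt0 e_gt0 C_gt0).
have E1 : 0 < E + 1 by rewrite ltr_wpDl.
have hfix := partial_sums_near n0 (divr_gt0 e_gt0 E1).
have [n1 hq] := q_o e_gt0.
near=> x => K KE; have x_gt0 : 0 < x by near: x; exact: nbhs_pinfty_gt.
have hfixx : forall n, (n < n0)%N -> s n.+1 x <= (n.+1%:R + e / (E + 1)) * Gbar x.
  by near: x.
have hlargex : forall n, (0 < n)%N ->
    s n x <= C * n%:R * Gbar x + C * (n%:R / x) ^+ p.+1 by near: x.
have hpowx : forall K, K%:R <= x ->
    \sum_(0 <= n < K) dlt n * (n.+1%:R / x) ^+ p.+1 <= e / C * Gbar x by near: x.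
have Kx : K%:R <= x by rewrite KE truncn_le// ltW.
have xK : x < K.+1%:R by rewrite KE truncnS_gt.
have xn0 : n0%:R <= x by near: x; apply: nbhs_pinfty_ge; exact: num_real.
have xn1 : n1%:R <= x by near: x; apply: nbhs_pinfty_ge; exact: num_real.
have n0K : (n0 <= K)%N by rewrite -ltnS -(ltr_nat R) (le_lt_trans xn0).
have n1K : (n1 <= K.+1)%N by rewrite -(ler_nat R) ltW// (le_lt_trans xn1).
have -> : (E + eta) * Gbar x =
  e * Gbar x + ((E + e) * Gbar x + (e * Gbar x + e * Gbar x)) by rewrite /e; field.
apply: lerD.
  by apply: (le_trans (hq _ n1K)); rewrite ler_pM2l// Gbar_nincr// ltW.
rewrite (big_cat_nat _ n0K)//=; apply: lerD.
  apply: (@le_trans _ _ (\sum_(0 <= n < n0) dlt n * ((n.+1%:R + e / (E + 1)) * Gbar x))).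
    rewrite !big_mkord; apply: ler_sum => n _; apply: ler_wpM2l; first exact: dlt_ge0.
    exact: hfixx.
  have hd : \sum_(0 <= n < n0) dlt n <= E.
    apply: le_trans (moment1 n0); apply: ler_sum => n _.
    by rewrite -[leLHS]mulr1 ler_wpM2l// ler1n.
  have -> : \sum_(0 <= n < n0) dlt n * ((n.+1%:R + e / (E + 1)) * Gbar x) =
     (\sum_(0 <= n < n0) dlt n * n.+1%:R + (\sum_(0 <= n < n0) dlt n) * (e / (E + 1))) * Gbar x.
    rewrite mulr_suml -big_split mulr_suml; apply: eq_bigr => n _ /=; ring.
  rewrite ler_pM2r// lerD//.
  rewrite mulrCA -[leRHS]mulr1 ler_pM2l// ler_pdivrMr// mul1r (le_trans hd)// lerDl//.
apply: (@le_trans _ _ (\sum_(n0 <= n < K) dlt n * (C * n.+1%:R * Gbar x + C * (n.+1%:R / x) ^+ p.+1))).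
  apply: ler_sum => n _; apply: ler_wpM2l; first exact: dlt_ge0.
  exact: hlargex.
have -> : \sum_(n0 <= n < K) dlt n * (C * n.+1%:R * Gbar x + C * (n.+1%:R / x) ^+ p.+1) =
    C * (\sum_(n0 <= n < K) dlt n * n.+1%:R) * Gbar x +
    C * (\sum_(n0 <= n < K) dlt n * (n.+1%:R / x) ^+ p.+1).
  by rewrite !mulr_sumr mulr_suml -big_split; apply: eq_bigr => n _ /=; ring.
apply: lerD.
  rewrite ler_pM2r// mulrC -ler_pdivlMr//; exact: hn0.
rewrite mulrC -ler_pdivlMr// mulrAC.
apply: (@le_trans _ _ (\sum_(0 <= n < K) dlt n * (n.+1%:R / x) ^+ p.+1)).
  rewrite [leRHS](big_cat_nat _ n0K)//= lerDr sumr_ge0// => n _.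
  by rewrite mulr_ge0 ?exprn_ge0 ?divr_ge0// ltW.
exact: hpowx.
Unshelve. all: by end_near. Qed.

End RandomSumTail.

(** * Landau notation at infinity *)

Section LandauAtInfinity.
Context (R : realType).
Implicit Types f g : R -> R.

Lemma littleo_pinftyP f g : f =o_ (pinfty_nbhs R) g <->
  forall e : R, 0 < e -> \forall x \near +oo, `|f x| <= e * `|g x|.
Proof. by split => [/eqoP|h]; [|apply/eqoP]. Qed.

Lemma equiv_pinftyP f g :
  (forall e : R, 0 < e -> \forall x \near +oo, `|f x - g x| <= e * `|g x|) ->
  f ~_ (pinfty_nbhs R) g.
Proof. by move=> h; apply/eqaddoP. Qed.

Lemma near_pinfty_nat (Q : R -> Prop) : (\forall x \near +oo, Q x) ->
  exists n1, forall n, (n1 <= n)%N -> Q n%:R.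
Proof.
move=> [A [_ hA]]; exists (Num.truncn A).+1 => n An; apply: hA.
by rewrite (lt_le_trans (truncnS_gt A))// ler_nat.
Qed.

End LandauAtInfinity.

(** * Independence of claims and renewals *)

Section Independence.
Context (R : realType) (d : measure_display) (T : measurableType d).
Variable P : probability T R.

Lemma indep_generated (E : set T) (G : set (set T)) :
  measurable E -> setI_closed G -> (forall B, G B -> measurable B) ->
  (forall B, G B -> P (E `&` B) = (P E * P B)%E) ->
  forall B, <<s G >> B -> measurable B /\ P (E `&` B) = (P E * P B)%E.
Proof.
move=> mE GI mG EG B sGB.
suff: <<s G >> `<=` [set B | measurable B /\ P (E `&` B) = (P E * P B)%E].
  by move=> /(_ _ sGB).
apply: lambda_system_subset; [by []| |by move=> C GC; split; [exact: mG|exact: EG]|by []].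
apply/dynkin_lambda_system; split.
- by split => //; rewrite setIT probability_setT mule1.
- move=> C [mC EC]; split; first exact: measurableC.
  have DI : P E = (P (E `&` ~` C) + P (E `&` C))%E := measureDI P mE mC.
  have mEC := measurableI _ _ mE (measurableC mC).
  move: DI; rewrite EC probability_setC// -(fine_probK P mE) -(fine_probK P mC).
  rewrite -(fine_probK P mEC) -EFinM -EFinB -EFinM -EFinD => -[h].
  congr (_%:E); move: h.
  move: (fine (P E)) (fine (P C)) (fine (P (E `&` ~` C))) => p1 p2 p3 h; lra.
- move=> F tF FH; have mF i : measurable (F i) by case: (FH i).
  split; first exact: bigcupT_measurable.
  rewrite setI_bigcupr measure_semi_bigcup//; last 3 first.
  + by move=> i; exact: measurableI.
  + exact: trivIset_setIl.
  + by apply: bigcupT_measurable => i; exact: measurableI.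
  rewrite measure_semi_bigcup//; last exact: bigcupT_measurable.
  rewrite (eq_eseriesr (fun n _ => proj2 (FH n))).
  rewrite -(fine_probK P mE) nneseriesZl//.
Qed.

End Independence.

Section RenewalEvents.
Context (R : realType) (d : measure_display) (T : measurableType d).
Variable P : probability T R.
Variables (Y Z : nat -> {RV P >-> R}) (tau : {RV P >-> R}).
Hypothesis indep : independent3 P (sigma_seq Y) (sigma_seq Z) (sigma_rv tau).

Let gens (X : nat -> {RV P >-> R}) : set (set T) :=
  \bigcup_i preimage_set_system setT (X i) (@measurable _ (measurableTypeR R)).

Lemma sigma_seq_preimage (X : nat -> {RV P >-> R}) i (B : set R) :
  measurable B -> sigma_seq X (X i @^-1` B).
Proof.
by move=> mB; apply: sub_sigma_algebra; exists i => //; exists B; rewrite ?setTI.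
Qed.

Lemma sigma_seq_measurable (X : nat -> {RV P >-> R}) A : sigma_seq X A -> measurable A.
Proof.
apply: smallest_sub; first exact: sigma_algebra_measurable.
move=> _ [i _ [B mB <-]]; exact: (measurable_funPT (X i)).
Qed.

Lemma sigma_seqT (X : nat -> {RV P >-> R}) : sigma_seq X setT.
Proof. exact: (@measurableT _ (g_sigma_algebraType (gens X))). Qed.

Lemma sigma_seqI (X : nat -> {RV P >-> R}) : setI_closed (sigma_seq X).
Proof. exact: (@measurableI _ (g_sigma_algebraType (gens X))). Qed.

Lemma sigma_seq_gt_sum n x : sigma_seq Y [set w | x < \sum_(i < n) Y i w].
Proof.
have mY i : measurable_fun (setT : set (g_sigma_algebraType (gens Y))) (Y i).
  by move=> _ B mB; rewrite setTI; exact: sigma_seq_preimage.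
apply: (@measurable_ltr_set R _ (g_sigma_algebraType (gens Y))) => //.
exact: (@measurable_psum R _ (g_sigma_algebraType (gens Y)) (fun i => Y i)).
Qed.

Lemma sigma_seq_gt i x : sigma_seq Y [set w | x < Y i w].
Proof.
have mY : measurable_fun (setT : set (g_sigma_algebraType (gens Y))) (Y i).
  by move=> _ B mB; rewrite setTI; exact: sigma_seq_preimage.
exact: (@measurable_ltr_set R _ (g_sigma_algebraType (gens Y))).
Qed.

Let rect : set (set T) :=
  [set B | exists E2 E3, [/\ sigma_seq Z E2, sigma_rv tau E3 & B = E2 `&` E3]].

Let RT := g_sigma_algebraType rect.

Let sigma_rvT : sigma_rv tau setT.
Proof. by exists setT => //; rewrite setTI. Qed.

Let mZ i : measurable_fun (setT : set RT) (Z i).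
Proof.
move=> _ B mB; rewrite setTI; apply: sub_sigma_algebra.
exists (Z i @^-1` B), setT; split => //; last by rewrite setIT.
exact: sigma_seq_preimage.
Qed.

Let mtau : measurable_fun (setT : set RT) tau.
Proof.
move=> _ B mB; rewrite setTI; apply: sub_sigma_algebra.
exists setT, (tau @^-1` B); split; last by rewrite setTI.
  exact: sigma_seqT.
by exists B => //; rewrite setTI.
Qed.

(** The rectangles form a pi-system that generates the events of the pair (Z, tau),
and the three-fold product rule settles the case of a rectangle. *)
Lemma indep_claims_renewals E B : sigma_seq Y E -> <<s rect >> B ->
  fine (P (B `&` E)) = fine (P B) * fine (P E).
Proof.
move=> YE sB; rewrite setIC mulrC.
have mE := sigma_seq_measurable YE.
have mtau' E3 : sigma_rv tau E3 -> measurable E3.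
  by move=> [C mC <-]; exact: (measurable_funPT tau).
have P12 E2 : sigma_seq Z E2 -> P (E `&` E2) = (P E * P E2)%E.
  move=> ZE2; have := indep YE ZE2 sigma_rvT.
  by rewrite setIT probability_setT mule1.
have P23 E2 E3 : sigma_seq Z E2 -> sigma_rv tau E3 -> P (E2 `&` E3) = (P E2 * P E3)%E.
  move=> ZE2 tE3; have := indep (@sigma_seqT Y) ZE2 tE3.
  by rewrite setTI probability_setT mul1e.
have [] := @indep_generated _ _ _ P E rect mE _ _ _ B sB.
- move=> _ _ [E2 [E3 [ZE2 tE3 ->]]] [F2 [F3 [ZF2 tF3 ->]]].
  exists (E2 `&` F2), (E3 `&` F3); split; last by rewrite setIACA.
    exact: sigma_seqI.
  case: tE3 tF3 => [A mA <-] [C mC <-].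
  by exists (A `&` C); [exact: measurableI|rewrite !setTI preimage_setI].
- move=> _ [E2 [E3 [ZE2 tE3 ->]]]; apply: measurableI; last exact: mtau'.
  exact: sigma_seq_measurable ZE2.
- move=> _ [E2 [E3 [ZE2 tE3 ->]]].
  by rewrite setIA (indep YE ZE2 tE3) P23// muleA.
by move=> mB ->; rewrite fineM ?fin_num_measure.
Qed.

(** N(tau) >= n, written with all initial partial sums so that the sets decrease
in n also on the null event where some Z_i is negative. *)
Definition renewed n : set T :=
  [set w | forall k, (k <= n)%N -> \sum_(i < k) Z i w <= tau w].

Lemma renewed_nincr n : renewed n.+1 `<=` renewed n.
Proof. by move=> w h k kn; apply: h; rewrite ltnW. Qed.

Let renewed_rect n : <<s rect >> (renewed n).
Proof.
have -> : renewed n = \bigcap_(k in `I_n.+1) [set w | \sum_(i < k) Z i w <= tau w].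
  by apply/seteqP; split.
apply: (@bigcap_measurableType _ RT) => k _; apply: (@measurable_ler_set R _ RT) => //.
exact: (@measurable_psum R _ RT (fun i => Z i)).
Qed.

Let rect_measurable B : <<s rect >> B -> measurable B.
Proof.
apply: smallest_sub; first exact: sigma_algebra_measurable.
move=> _ [E2 [E3 [ZE2 [C mC <-] ->]]]; apply: measurableI.
  exact: sigma_seq_measurable ZE2.
exact: (measurable_funPT tau).
Qed.

Lemma measurable_renewed n : measurable (renewed n).
Proof. exact: rect_measurable. Qed.

Lemma indep_renewed_sum n x :
  fine (P ((renewed n `\` renewed n.+1) `&` [set w | x < \sum_(i < n) Y i w])) =
  (fine (P (renewed n)) - fine (P (renewed n.+1))) *
    fine (P [set w | x < \sum_(i < n) Y i w]).
Proof.
rewrite indep_claims_renewals; last 2 first.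
- exact: sigma_seq_gt_sum.
- apply: (@measurableD _ RT); exact: renewed_rect.
congr (_ * _).
have mD k := measurable_renewed k.
have DI : P (renewed n) = (P (renewed n `\` renewed n.+1) + P (renewed n `&` renewed n.+1))%E
  := measureDI P (mD n) (mD n.+1).
rewrite DI fineD ?fin_num_measure//; last 2 first.
- exact: measurableD.
- exact: measurableI.
by rewrite (setIidr (@renewed_nincr n)) addrK.
Qed.

Lemma indep_renewed_gt n (t : R) i x :
  fine (P ((renewed n `&` [set w | tau w <= t]) `&` [set w | x < Y i w])) =
  fine (P (renewed n `&` [set w | tau w <= t])) * fine (P [set w | x < Y i w]).
Proof.
rewrite indep_claims_renewals//; first exact: sigma_seq_gt.
apply: (@measurableI _ RT); first exact: renewed_rect.
exact: (@measurable_ler_set R _ RT).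
Qed.

End RenewalEvents.

(** * Counting events and the renewal count *)

Section CountingSeries.
Context (R : realType) (d : measure_display) (T : measurableType d).
Variable P : probability T R.
Variable C : nat -> set T.
Hypothesis mC : forall n, measurable (C n).

Lemma measurable_count : measurable_fun setT (fun w => \sum_(n <oo) (\1_(C n) w : R)%:E)%E.
Proof.
apply: ge0_emeasurable_sum => [k x _ _|k _]; first by rewrite lee_fin.
by apply/measurable_EFinP/measurable_indic.
Qed.

Lemma integral_count :
  (\int[P]_w (\sum_(n <oo) (\1_(C n) w : R)%:E) = \sum_(n <oo) P (C n))%E.
Proof.
rewrite integral_nneseries//; last by move=> n; apply/measurable_EFinP/measurable_indic.
by apply: eq_eseriesr => n _; rewrite integral_indic// setIT.
Qed.

End CountingSeries.

Section NonnegSeries.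
Context (R : realType).
Variable u : nat -> R.
Hypothesis u_ge0 : forall n, 0 <= u n.

Lemma nneseries_EFin_le (b : R) :
  (forall K, \sum_(0 <= n < K) u n <= b) -> (\sum_(n <oo) (u n)%:E <= b%:E)%E.
Proof.
move=> ub; apply: lime_le.
  by apply: is_cvg_nneseries => n _ _; rewrite lee_fin.
by apply: nearW => K; rewrite sumEFin lee_fin.
Qed.

Lemma nneseries_EFin_ge K : ((\sum_(0 <= n < K) u n)%:E <= \sum_(n <oo) (u n)%:E)%E.
Proof.
by rewrite -sumEFin; apply: nneseries_lim_ge => n _ _; rewrite lee_fin.
Qed.

End NonnegSeries.

Section RenewalCount.
Context (R : realType) (d : measure_display) (T : measurableType d).
Variable P : probability T R.
Variables (Y Z : nat -> {RV P >-> R}) (tau : {RV P >-> R}) (c : R).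
Hypothesis tau_ge0 : forall w, 0 <= tau w.

Let B n := [set w | \sum_(i < n) Z i w <= tau w].

Let mB n : measurable (B n).
Proof.
apply: measurable_ler_set => //.
by apply: (measurable_psum (X := fun i => Z i)) => i; exact: measurable_funPT.
Qed.

Lemma renewal_countE w :
  renewal_count Z (tau w) w = (\sum_(n <oo) (\1_(B n.+1) w)%:E)%E.
Proof.
rewrite /renewal_count.
transitivity (\sum_(1 <= n <oo) (\1_(B n) w : R)%:E)%E.
  apply: eq_eseriesr => n _; congr (_%:E); rewrite !indicE.
rewrite -(nneseries_addn (f := fun n => (\1_(B n) w)%:E) 1)//.
under eq_eseriesr do rewrite addn1.
by [].
Qed.

Lemma renewed_count_ge n w : renewed Z tau n w ->
  (n%:R%:E <= renewal_count Z (tau w) w)%E.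
Proof.
move=> Dn; rewrite renewal_countE.
apply: le_trans (nneseries_EFin_ge (u := fun k => \1_(B k.+1) w) _ n) => //.
rewrite lee_fin (eq_big_nat _ _ (F2 := fun=> 1)); last first.
  by move=> k /andP[_ kn]; rewrite indicE mem_set//; exact: Dn.
by rewrite big_mkord sumr_const card_ord.
Qed.

(** For nonnegative Z the partial sums increase, so a renewal epoch k <= n beyond tau
leaves at most k - 1 epochs up to tau. *)
Lemma renewed_of_count n w : (forall i, 0 <= Z i w) ->
  (n%:R%:E <= renewal_count Z (tau w) w)%E -> renewed Z tau n w.
Proof.
move=> Zw nN k kn; apply: contrapT => /negP; rewrite -ltNge => tk.
have Zmono m1 m2 : (m1 <= m2)%N -> \sum_(i < m1) Z i w <= \sum_(i < m2) Z i w.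
  move=> m12; rewrite -!(big_mkord xpredT (fun i => Z i w)) [leRHS](big_cat_nat _ m12)//=.
  by rewrite lerDl sumr_ge0.
case: k => [|k] in kn tk *; first by move: tk; rewrite big_ord0 ltNge tau_ge0.
have : (n%:R%:E <= k%:R%:E :> \bar R)%E.
  apply: (le_trans nN); rewrite renewal_countE; apply: nneseries_EFin_le => [//|K].
  have := @sum_le_prefix R (fun m => \1_(B m.+1) w) 0 k K (fun _ => ler0n _ _) (lexx _).
  rewrite mulr0 addr0 => h; apply: (le_trans (h _)).
    move=> m /andP[km _]; rewrite indicE memNset// /B/= => /le_lt_trans /(_ tk).
    by apply/negP; rewrite -leNgt; exact: Zmono.
  rewrite big_mkord -[X in _ <= X%:R](card_ord k) -sumr_const.
  by apply: ler_sum => i _; rewrite indicE; case: (_ \in _).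
by rewrite lee_fin ler_nat leqNgt kn.
Qed.

Let mcount : measurable_fun setT (fun w => renewal_count Z (tau w) w).
Proof.
under eq_fun do rewrite renewal_countE.
exact: measurable_count.
Qed.

Lemma ruinP x w : (x%:E < max_net_loss Y Z tau c w)%E <->
  exists2 n, (n%:R%:E <= renewal_count Z (tau w) w)%E & x < net_loss Y Z c n w.
Proof.
split=> [/ereal_sup_gt[_ [n nN <-]]|[n nN xn]].
  by rewrite lte_fin; exists n.
apply: (@lt_le_trans _ _ (net_loss Y Z c n w)%:E); first by rewrite lte_fin.
by apply: ereal_sup_ubound; exists n.
Qed.

Lemma measurable_ruin x : measurable [set w | (x%:E < max_net_loss Y Z tau c w)%E].
Proof.
rewrite (_ : mkset _ = \bigcup_n ([set w | (n%:R%:E <= renewal_count Z (tau w) w)%E]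
    `&` [set w | x < net_loss Y Z c n w])); last first.
  apply/seteqP; split => w /=.
    by move=> /ruinP[n nN xn]; exists n.
  by move=> [n _ [nN xn]]; apply/ruinP; exists n.
apply: bigcupT_measurable => n; apply: measurableI.
  rewrite -[X in measurable X]setTI; exact: emeasurable_fun_c_infty.
apply: measurable_ltr_set => //.
apply: (measurable_psum (X := fun i w => Y i w - c * Z i w)) => i.
apply: measurable_funB; first exact: measurable_funPT.
by apply: measurable_funM => //; exact: measurable_funPT.
Qed.

Hypothesis Z_ge0 : {ae P, forall w, forall i, 0 <= Z i w}.

Let q n := fine (P (renewed Z tau n)).

(** For nonnegative Z the last of the conditions defining [renewed] implies the
others. *)
Lemma renewed_prob n : fine (P [set w | \sum_(i < n) Z i w <= tau w]) = q n.
Proof.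
apply/eqP; rewrite eq_le; apply/andP; split; apply: le_fine_prob_ae.
- exact: mB.
- exact: measurable_renewed.
- apply: filterS Z_ge0 => w Zw nt k kn; apply: le_trans nt.
  rewrite -!(big_mkord xpredT (fun i => Z i w)) [leRHS](big_cat_nat _ kn)//=.
  by rewrite lerDl sumr_ge0.
- exact: measurable_renewed.
- exact: mB.
- by apply: nearW => w; exact.
Qed.

Lemma mean_countE : mean_count Z tau = (\sum_(n <oo) (q n.+1)%:E)%E.
Proof.
rewrite /mean_count; under eq_integral do rewrite renewal_countE.
rewrite integral_count//.
apply: eq_eseriesr => n _; rewrite -renewed_prob fine_probK//.
exact: mB.
Qed.

End RenewalCount.

(** * Two-sided bounds for the ruin probability *)

Section RuinSandwich.
Context (R : realType) (d : measure_display) (T : measurableType d).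
Variable P : probability T R.
Variables (Y Z : nat -> {RV P >-> R}) (tau : {RV P >-> R}) (c : R).
Hypothesis tau_ge0 : forall w, 0 <= tau w.
Hypothesis c_gt0 : 0 < c.
Hypothesis Y_ge0 : {ae P, forall w, forall i, 0 <= Y i w}.
Hypothesis Z_ge0 : {ae P, forall w, forall i, 0 <= Z i w}.
Hypothesis indep : independent3 P (sigma_seq Y) (sigma_seq Z) (sigma_rv tau).

Let D n := renewed Z tau n.
Let q n := fine (P (D n)).
Let mD n : measurable (D n) := measurable_renewed Z tau n.

Let mY i : measurable_fun setT (Y i). Proof. exact: measurable_funPT. Qed.

Let mS n : measurable_fun setT (fun w => \sum_(i < n) Y i w).
Proof. exact: (measurable_psum (X := fun i => Y i)). Qed.

(** Net losses are at most S_n, and S_n increases with n. Ruin thus requires either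
N > K, or S_n > x at the value n <= K of N. *)
Lemma ruin_prob_le x K : 0 <= x ->
  ruin_prob Y Z tau c x <= q K.+1 + \sum_(0 <= n < K)
    (q n.+1 - q n.+2) * fine (P [set w | x < \sum_(i < n.+1) Y i w]).
Proof.
move=> x0.
rewrite big_mkord.
under eq_bigr do rewrite -indep_renewed_sum//.
apply: (union_bound_ae (C := fun n => (D n.+1 `\` D n.+2) `&`
   [set w | x < \sum_(i < n.+1) Y i w])).
- move=> n; apply: measurableI; first exact: measurableD.
  exact: measurable_ltr_set.
- exact: measurable_ruin.
- exact: mD.
apply: filterS2 Y_ge0 Z_ge0 => w Yw Zw /ruinP[n nN xn].
have Dn : D n w by apply: (renewed_of_count tau_ge0).
have Smono m1 m2 : (m1 <= m2)%N -> \sum_(i < m1) Y i w <= \sum_(i < m2) Y i w.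
  move=> m12; rewrite -!(big_mkord xpredT (fun i => Y i w)) [leRHS](big_cat_nat _ m12)//=.
  by rewrite lerDl sumr_ge0.
have xS : x < \sum_(i < n) Y i w.
  apply: (lt_le_trans xn); apply: ler_sum => i _.
  by rewrite gerBl mulr_ge0// ltW.
case: n => [|n] in nN xn Dn xS *; first by move: xS; rewrite big_ord0 ltNge x0.
have [?|DK] := pselect (D K.+1 w); [by left|right].
apply: contrapT => no; apply: DK.
have Danti k m : (k <= m)%N -> D m w -> D k w.
  by move=> km Dm j jk; apply: Dm; exact: leq_trans km.
suff /(_ K)[|//] : forall m, D (n.+1 + m)%N w \/ D K.+1 w.
  by apply: Danti; rewrite addSn ltnS leq_addl.
elim=> [|m [Dm|]]; [by left; rewrite addn0| |by right].
have [Dm1|nDm1] := pselect (D (n.+1 + m.+1)%N w); first by left.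
right; have [Km|mK] := leqP K.+1 (n.+1 + m); first exact: Danti Dm.
exfalso; apply: no; exists (n + m)%N; first by rewrite -ltnS -addSn.
split; first by split; [rewrite -addSn|rewrite -addSn -addnS].
by apply: lt_le_trans xS _; apply: Smono; rewrite ltnS leq_addr.
Qed.

(** If the i-th claim exceeds x + c * t and at least i renewals occur up to tau <= t,
then the net loss at the i-th renewal exceeds x. The number of such i < n0 is at
most 1 on the ruin event, plus n0 where two claims are that large. *)
Lemma ruin_prob_ge x n0 (t : R) :
  (forall i s, fine (P [set w | s < Y i w]) = fine (P [set w | s < Y 0%N w])) ->
  \sum_(0 <= i < n0) fine (P (D i.+1 `&` [set w | tau w <= t])) *
     fine (P [set w | x + c * t < Y 0%N w])
  <= ruin_prob Y Z tau c x + n0%:R *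
     fine (P [set w | exists i j, [/\ (i < j < n0)%N, x + c * t < Y i w & x + c * t < Y j w]]).
Proof.
move=> Y_id; pose F i := (D i.+1 `&` [set w | tau w <= t]) `&` [set w | x + c * t < Y i w].
pose Q := [set w | exists i j, [/\ (i < j < n0)%N, x + c * t < Y i w & x + c * t < Y j w]].
have mQ : measurable Q by exact: measurable_pairs.
have mF i : measurable (F i).
  apply: measurableI; last exact: measurable_ltr_set.
  by apply: measurableI => //; apply: measurable_ler_set => //; exact: measurable_funPT.
pose A := [set w | (x%:E < max_net_loss Y Z tau c w)%E].
have mA : measurable A by exact: measurable_ruin.
have -> : \sum_(0 <= i < n0) fine (P (D i.+1 `&` [set w | tau w <= t])) *
     fine (P [set w | x + c * t < Y 0%N w]) = \sum_(i < n0) 1 * fine (P (F i)).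
  rewrite big_mkord; apply: eq_bigr => i _.
  by rewrite mul1r /F indep_renewed_gt// [in RHS]Y_id.
have -> : ruin_prob Y Z tau c x + n0%:R * fine (P Q) =
    \sum_(b : bool) (if b then 1 else n0%:R) * fine (P (if b then A else Q)).
  by rewrite big_bool mul1r.
apply: weighted_indic_le => //.
- by case=> //=; rewrite ler0n.
- by case.
apply: filterS2 Y_ge0 Z_ge0 => w Yw Zw.
under eq_bigr do rewrite mul1r.
rewrite big_bool mul1r.
have FA i : F i w -> A w.
  move=> [[Di taut] xY]; apply/ruinP; exists i.+1; first exact: renewed_count_ge.
  rewrite /net_loss sumrB -mulr_sumr ltrBrDr.
  have Zt : \sum_(j < i.+1) Z j w <= t by apply: le_trans taut; exact: Di.
  apply: (@le_lt_trans _ _ (x + c * t)); first by rewrite lerD2l ler_pM2l.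
  apply: (lt_le_trans xY); rewrite big_ord_recr/= lerDr sumr_ge0//.
have [[i0 Fi0]|no] := pselect (exists i : 'I_n0, F i w); last first.
  rewrite big1 ?addr_ge0 ?mulr_ge0// => i _; rewrite indicE memNset// => Fi.
  by apply: no; exists i.
rewrite [\1_A w]indicE (mem_set (FA _ Fi0)).
have [Qw|noQ] := pselect (Q w).
  rewrite [\1_Q w]indicE (mem_set Qw) mulr1 -[leLHS]add0r lerD//.
  rewrite -[X in _ <= X%:R](card_ord n0) -sumr_const.
  by apply: ler_sum => i _; rewrite indicE; case: (_ \in _).
rewrite [\1_Q w]indicE (memNset noQ) (bigD1 i0)//= big1.
  by rewrite mulr0 !addr0 indicE; case: (_ \in _).
move=> i ii0; rewrite indicE memNset// => Fi; apply: noQ.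
have : (i != i0 :> nat) by [].
rewrite neq_ltn => /orP[ii|ii].
  by exists i, i0; split; [rewrite ii ltn_ord|case: Fi|case: Fi0].
by exists i0, i; split; [rewrite ii ltn_ord|case: Fi0|case: Fi].
Qed.

End RuinSandwich.

(** * Tail of the number of renewals *)

Section RenewalTail.
Context (R : realType).

(** exp (kappa * n) >= (kappa * n / s) ^ s, the s-th power of exp t >= t, used with
s = l + p + 1. *)
Lemma poly_exp_decay (kappa : R) l p : 0 < kappa -> exists2 K, 0 < K &
  forall n, (0 < n)%N ->
    n%:R ^+ l * expR (- kappa) ^+ n <= K * n%:R^-1 ^+ p.+1.
Proof.
move=> k0; pose s := (l + p.+1)%N.
have s0 : 0 < s%:R :> R by rewrite ltr0n /s addnS.
exists ((s%:R / kappa) ^+ s); first by rewrite exprn_gt0// divr_gt0.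
move=> n n0; have nR : 0 < n%:R :> R by rewrite ltr0n.
pose t := kappa * n%:R / s%:R.
have t0 : 0 < t by rewrite divr_gt0// mulr_gt0.
have tE : t ^+ s <= expR (kappa * n%:R).
  rewrite (_ : kappa * n%:R = s%:R * t); last by rewrite /t; field; rewrite gt_eqF.
  rewrite expRM_natl lerXn2r ?nnegrE ?expR_ge0 ?(ltW t0)//.
  by apply: le_trans (expR_ge1Dx t); rewrite lerDr.
rewrite -expRM_natl mulrN expRN mulrC [_ * kappa]mulrC.
rewrite ler_pdivrMl ?expR_gt0//.
apply: (@le_trans _ _ (t ^+ s * ((s%:R / kappa) ^+ s * n%:R^-1 ^+ p.+1))).
  rewrite mulrA -exprMn (_ : t * (s%:R / kappa) = n%:R); last first.
    by rewrite /t; field; rewrite !gt_eqF.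
  by rewrite /s exprD -mulrA -exprMn mulfV ?gt_eqF// expr1n mulr1.
rewrite ler_wpM2r// mulr_ge0// exprn_ge0// ?invr_ge0 ?ltW// divr_gt0//.
Qed.

Section Decay.
Context (d : measure_display) (T : measurableType d).
Variables (P : probability T R) (Z : nat -> {RV P >-> R}) (tau : {RV P >-> R}).
Variables (gL : nat -> R) (b delta : R) (Gbar : R -> R).
Hypothesis Gbar_gt0 : forall x, 0 < Gbar x.
Hypothesis Gbar_nincr : forall x z, x <= z -> Gbar z <= Gbar x.
Hypothesis Gbar_cv : forall eta : R, 0 < eta < 1 -> exists2 y, 1 < y &
  \forall x \near +oo%R, (1 - eta) * Gbar x <= Gbar (x * y).
Hypothesis Z_ge0 : {ae P, forall w, forall i, 0 <= Z i w}.
Hypothesis Z_LOD : forall n (x : nat -> R), (1 <= n)%N ->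
  fine (P (\bigcap_(i < n) [set w | Z i w <= x i])) <=
    gL n * \prod_(i < n) fine (P [set w | Z i w <= x i]).
Hypothesis gL_gt0 : forall n, (1 <= n)%N -> 0 < gL n.
Hypothesis gL_poly : exists l n1, forall n, (n1 <= n)%N -> gL n <= n%:R ^+ l.
Hypothesis b01 : 0 < b <= 1.
Hypothesis delta01 : 0 < delta <= 1.
Hypothesis Z_law : forall i, fine (P [set w | Z i w <= b]) <= 1 - delta.
Hypothesis tau_small : forall e : R, 0 < e ->
  \forall x \near +oo%R, fine (P [set w | x < tau w]) <= e * Gbar x.

Let mZ i : measurable_fun setT (Z i). Proof. exact: measurable_funPT. Qed.

(** n renewals up to tau require that tau > a * n or that n inter-arrival times sum
to at most a * n, where a = b * delta / 4 < 1 is the rate in [small_sum_bound]. *)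
Lemma renewed_prob_small (eta : R) : 0 < eta ->
  exists n1, forall n, (n1 <= n)%N -> fine (P (renewed Z tau n)) <= eta * Gbar n%:R.
Proof.
move=> eta0; have eta2 : 0 < eta / 2 by rewrite divr_gt0.
have /andP[b0 b1] := b01; have /andP[d0 d1] := delta01.
pose a := b * delta / 4.
have a0 : 0 < a by rewrite divr_gt0// mulr_gt0.
have a1 : a < 1.
  have : b * delta <= 1 by apply: mulr_ile1 => //; exact: ltW.
  by rewrite /a ltr_pdivrMr// mul1r => /le_lt_trans; apply; rewrite ltr1n.
have [|C C0 hscale] := Gbar_scale Gbar_gt0 Gbar_nincr Gbar_cv (a := a); first by rewrite a0.
have [x0 [C1 [p [_ _ _ poly]]]] := potter_poly Gbar_gt0 Gbar_nincr Gbar_cv.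
have [l [n0 hgL]] := gL_poly.
have [|K K0 hK] := @poly_exp_decay (delta / 4) l p; first by rewrite divr_gt0.
have htau := tau_small (divr_gt0 eta2 C0).
have {}htau : \forall x \near +oo%R,
    fine (P [set w | a * x < tau w]) <= eta / 2 / C * Gbar (a * x).
  case: htau => A [_ hA]; near=> x; apply: hA; rewrite mulrC -ltr_pdivrMr//.
  by near: x; apply: nbhs_pinfty_gt; exact: num_real.
have [n1 hn1] := near_pinfty_nat (filterI (poly K _ K0 eta2) (filterI hscale htau)).
exists (maxn 1 (maxn n0 n1)) => n; rewrite !geq_max => /and3P[npos nn0 nn1].
have [hpoly [hsc ht]] := hn1 n nn1.
pose A1 := [set w | \sum_(i < n) Z i w <= n%:R * (b * delta / 4)].
pose A2 := [set w | a * n%:R < tau w].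
have mA1 : measurable A1.
  by apply: measurable_ler_set => //; exact: (measurable_psum (X := fun i => Z i)).
have mA2 : measurable A2 by apply: measurable_ltr_set => //; exact: measurable_funPT.
have : fine (P (renewed Z tau n)) <= fine (P A1) + \sum_(i < 1) fine (P A2).
  apply: (union_bound_ae (C := fun=> A2)) => //; first exact: measurable_renewed.
  apply: nearW => w Dw; have [tw|tw] := ltP (a * n%:R) (tau w); first by right; exists 0%N.
  by left; rewrite /A1/=; apply: le_trans (Dw n (leqnn n)) _; rewrite mulrC.
rewrite big_ord1 => /le_trans; apply.
have -> : eta * Gbar n%:R = eta / 2 * Gbar n%:R + eta / 2 * Gbar n%:R by field.
apply: lerD.
  apply: (le_trans (small_sum_bound Z_ge0 Z_LOD gL_gt0 b0 Z_law npos)).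
  apply: le_trans hpoly; apply: le_trans (hK n npos).
  by rewrite ler_wpM2r ?exprn_ge0 ?expR_ge0// hgL.
apply: (le_trans ht); rewrite -mulrA ler_wpM2l ?(ltW eta2)//.
by rewrite ler_pdivrMl.
Unshelve. all: by end_near. Qed.

End Decay.
End RenewalTail.

Section Summability.
Context (R : realType) (Gbar : R -> R) (mu : R).
Hypothesis Gbar_ge0 : forall x, 0 <= Gbar x.
Hypothesis Gbar_mean : forall (h : R) m, 0 <= h -> h * \sum_(k < m) Gbar (k.+1%:R * h) <= mu.

Lemma tail_dominated_sum_le (u : nat -> R) n1 : (forall n, 0 <= u n <= 1) ->
  (forall n, (n1 <= n)%N -> u n <= Gbar n%:R) ->
  forall K, \sum_(0 <= n < K) u n.+1 <= n1%:R + mu.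
Proof.
move=> u01 uG K.
apply: (@le_trans _ _ (\sum_(0 <= n < K) ((n < n1)%N%:R + Gbar n.+1%:R))).
  apply: ler_sum => n _; have /andP[_ u1] := u01 n.+1.
  have [nn|nn] := ltnP n n1; first by rewrite (le_trans u1)// lerDl.
  by rewrite add0r uG// ltnW.
rewrite big_split/= lerD//.
  have := @sum_le_prefix R (fun m => (m < n1)%N%:R) 0 n1 K (fun _ => ler0n _ _) (lexx _).
  rewrite mulr0 addr0 => h; apply: (le_trans (h _)).
    by move=> n /andP[nn _]; rewrite ltnNge nn.
  rewrite big_mkord -[X in _ <= X%:R](card_ord n1) -sumr_const.
  by apply: ler_sum => i _; case: (_ < _)%N.
have := Gbar_mean K ler01; rewrite mul1r big_mkord; apply: le_trans.
by apply: ler_sum => k _; rewrite mulr1.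
Qed.

End Summability.

Section Expectation.
Context (R : realType) (d : measure_display) (T : measurableType d).
Variables (P : probability T R) (tau : {RV P >-> R}).
Hypothesis tau_ge0 : forall w, 0 <= tau w.

(** tau is at most 1 plus the number of positive integers below it. *)
Lemma expectation_le_tail_sum (b : R) :
  (forall K, \sum_(0 <= n < K) fine (P [set w | n.+1%:R < tau w]) <= b) ->
  ('E_P[tau] <= (1 + b)%:E)%E.
Proof.
move=> hb.
pose C n := [set w | n.+1%:R < tau w].
have mC n : measurable (C n) by apply: measurable_ltr_set => //; exact: measurable_funPT.
rewrite unlock; apply: (@le_trans _ _ (\int[P]_w (1 + \sum_(n <oo) (\1_(C n) w : R)%:E))%E).
  apply: ge0_le_integral => //.
  - by move=> w _; rewrite lee_fin.
  - by apply/measurable_EFinP; exact: measurable_funPT.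
  - by apply: emeasurable_funD => //; exact: measurable_count.
  move=> w _; pose m := (Num.truncn (tau w)).+1.
  apply: (@le_trans _ _ (1 + (\sum_(0 <= n < m) (\1_(C n) w : R))%:E)%E).
    rewrite -EFinD lee_fin big_mkord.
    have := @sum_steps_ge R m 1 (tau w) ler01; rewrite mulr1 => /(_ _).
    rewrite ltW ?truncnS_gt// => /(_ isT); rewrite mul1r => /le_trans; apply.
    rewrite lerD2l; apply: ler_sum => i _; rewrite mulr1 indicE.
    by case: ltP => // it; rewrite mem_set.
  by rewrite leeD2l// nneseries_EFin_ge.
rewrite ge0_integralD//; last 2 first.
- by move=> w _; apply: nneseries_ge0 => n _ _; rewrite lee_fin.
- exact: measurable_count.
have -> : (\int[P]_(w in setT) 1 = 1)%E.
  by rewrite integral_cst// mul1e; exact: probability_setT.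
rewrite integral_count// EFinD leeD2l//.
rewrite (eq_eseriesr (g := fun n => (fine (P (C n)))%:E)); last first.
  by move=> n _; rewrite fine_probK.
by apply: nneseries_EFin_le => //; move=> n; exact: fine_prob_ge0.
Qed.

End Expectation.

(** * Asymptotic lower bound *)

Section RuinLower.
Context (R : realType) (d : measure_display) (T : measurableType d).
Variable P : probability T R.
Variables (Y Z : nat -> {RV P >-> R}) (tau : {RV P >-> R}) (c : R).
Variables (Gbar : R -> R) (M mu E : R).
Hypothesis tau_ge0 : forall w, 0 <= tau w.
Hypothesis c_gt0 : 0 < c.
Hypothesis Y_ge0 : {ae P, forall w, forall i, 0 <= Y i w}.
Hypothesis Z_ge0 : {ae P, forall w, forall i, 0 <= Z i w}.
Hypothesis indep : independent3 P (sigma_seq Y) (sigma_seq Z) (sigma_rv tau).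
Hypothesis Y_law : forall i t, fine (P [set w | t < Y i w]) = Gbar t.
Hypothesis M_gt0 : 0 < M.
Hypothesis Y_UOD : forall n (x : nat -> R), (1 <= n)%N ->
  fine (P (\bigcap_(i < n) [set w | x i < Y i w])) <=
    M * \prod_(i < n) fine (P [set w | x i < Y i w]).
Hypothesis Gbar_gt0 : forall x, 0 < Gbar x.
Hypothesis Gbar_nincr : forall x z, x <= z -> Gbar z <= Gbar x.
Hypothesis Gbar_cv : forall eta : R, 0 < eta < 1 -> exists2 y, 1 < y &
  \forall x \near +oo%R, (1 - eta) * Gbar x <= Gbar (x * y).
Hypothesis Gbar_mean : forall (h : R) m, 0 <= h -> h * \sum_(k < m) Gbar (k.+1%:R * h) <= mu.
Hypothesis tau_small : forall e : R, 0 < e ->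
  \forall x \near +oo%R, fine (P [set w | x < tau w]) <= e * Gbar x.
Hypothesis mean_count_fin : mean_count Z tau = E%:E.

Let q n := fine (P (renewed Z tau n)).

Let mtau t : measurable [set w | tau w <= t].
Proof. by apply: measurable_ler_set => //; exact: measurable_funPT. Qed.

Let E_ge0 : 0 <= E.
Proof.
have := nneseries_EFin_ge (fun n => fine_prob_ge0 P (renewed Z tau n.+1)) 0.
by rewrite -mean_countE// mean_count_fin lee_fin big_geq.
Qed.

Let partial_count (e : R) : 0 < e -> exists n0, E - e <= \sum_(0 <= n < n0) q n.+1.
Proof.
move=> e0; apply: contrapT => /forallNP h.
have : (mean_count Z tau <= (E - e)%:E)%E.
  rewrite mean_countE//; apply: nneseries_EFin_le.
    by move=> n; exact: fine_prob_ge0.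
  by move=> K; have /negP := h K; rewrite -ltNge => /ltW.
by rewrite mean_count_fin lee_fin; lra.
Qed.

(** The constants n0 and t are chosen so that P(N >= i, tau <= t), summed over
i <= n0, is close to E N; then x tends to infinity. *)
Lemma ruin_lower (eta : R) : 0 < eta ->
  \forall x \near +oo%R, (E - eta) * Gbar x <= ruin_prob Y Z tau c x.
Proof.
move=> eta0; pose e := eta / 4.
have e0 : 0 < e by rewrite divr_gt0.
have [n0 hn0] := partial_count e0.
have [t [t0 ht]] : exists t : R, 0 < t /\ n0%:R * fine (P [set w | t < tau w]) <= e.
  have n01 : 0 < n0%:R + 1 :> R by rewrite ltr_wpDl.
  have : \forall t \near +oo%R, 0 < t /\ (fine (P [set w | t < tau w]) <= 1 * Gbar t /\
      Gbar t <= e / (n0%:R + 1)).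
    apply: filterI; first exact: (nbhs_pinfty_gt (num_real 0)).
    apply: filterI; first exact: tau_small.
    by apply: (Gbar_small Gbar_mean); exact: divr_gt0.
  move=> /filter_ex[t [t0 [h1 h2]]]; exists t; split => //.
  move: h1; rewrite mul1r => /le_trans /(_ h2); rewrite ler_pdivlMr// => h.
  apply: le_trans h; rewrite mulrC ler_wpM2l ?fine_prob_ge0// lerDl//.
pose Q := \sum_(0 <= i < n0) fine (P (renewed Z tau i.+1 `&` [set w | tau w <= t])).
have QE : E - 2 * e <= Q.
  have : \sum_(0 <= n < n0) q n.+1 <=
      \sum_(0 <= i < n0) (fine (P (renewed Z tau i.+1 `&` [set w | tau w <= t])) +
        fine (P [set w | t < tau w])).
    apply: ler_sum => n _.
    have := @union_bound_ae _ _ _ P 1 (fun=> [set w | t < tau w]) (renewed Z tau n.+1)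
      (renewed Z tau n.+1 `&` [set w | tau w <= t]).
    rewrite big_ord1; apply.
    - by move=> _; apply: measurable_ltr_set => //; exact: measurable_funPT.
    - exact: measurable_renewed.
    - by apply: measurableI; [exact: measurable_renewed|exact: mtau].
    apply: nearW => w Dw; have [tw|tw] := ltP t (tau w); first by right; exists 0%N.
    by left; split.
  rewrite big_split/= -/Q sumr_const_nat subn0 -mulr_natl.
  by move: ht hn0; lra.
pose e' := e / (E + e + 1).
have e'01 : 0 < e' < 1.
  have h : 0 < E + e + 1 by rewrite ltr_wpDl// addr_ge0// ltW.
  by rewrite divr_gt0//= ltr_pdivrMr// mul1r; move: E_ge0; lra.
have Ee' : E * e' <= e.
  have h : 0 < E + e + 1 by rewrite ltr_wpDl// addr_ge0// ltW.
  by rewrite mulrA ler_pdivrMr// mulrC ler_pM2l//; lra.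
have hshift := Gbar_shift Gbar_nincr Gbar_cv (c * t) e'01.
have nM : 0 < n0%:R * ((n0 * n0)%:R * M) + 1.
  by rewrite ltr_wpDl// !mulr_ge0// ltW.
have hsmall := Gbar_small Gbar_mean (divr_gt0 e0 nM).
near=> x; have x0 : 0 < x by near: x; exact: nbhs_pinfty_gt.
set s := x + c * t.
have hs : (1 - e') * Gbar x <= Gbar s by rewrite /s; near: x.
have hx : Gbar x <= e / (n0%:R * ((n0 * n0)%:R * M) + 1) by near: x.
have sx : Gbar s <= Gbar x by apply: Gbar_nincr; rewrite /s lerDl mulr_ge0// ltW.
have := ruin_prob_ge (P := P) (Y := Y) (Z := Z) (tau := tau) c_gt0 Y_ge0 Z_ge0 indep x n0 t.
move=> /(_ _)/[!Y_law] lower.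
have {}lower : Q * Gbar s <= ruin_prob Y Z tau c x + n0%:R * ((n0 * n0)%:R * (M * Gbar s ^+ 2)).
  rewrite /Q mulr_suml; apply: (le_trans (lower _)); first by move=> i u; rewrite !Y_law.
  by rewrite lerD2l ler_wpM2l//; exact: pairs_bound.
have pairs : n0%:R * ((n0 * n0)%:R * (M * Gbar s ^+ 2)) <= e * Gbar x.
  have -> : n0%:R * ((n0 * n0)%:R * (M * Gbar s ^+ 2)) =
     n0%:R * ((n0 * n0)%:R * M) * Gbar s * Gbar s by rewrite expr2; ring.
  apply: ler_pM => //; rewrite ?mulr_ge0 ?(ltW M_gt0) ?(ltW (Gbar_gt0 _))//.
  move: hx; rewrite ler_pdivlMr// => hx; apply: le_trans hx.
  rewrite mulrC; apply: ler_pM => //; rewrite ?mulr_ge0 ?(ltW M_gt0) ?(ltW (Gbar_gt0 _))//.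
  by rewrite lerDl.
have h1 : (E - 2 * e) * Gbar s <= Q * Gbar s by rewrite ler_wpM2r// ltW.
have h2 : E * ((1 - e') * Gbar x) <= E * Gbar s by rewrite ler_wpM2l.
have h3 : E * e' * Gbar x <= e * Gbar x by rewrite ler_wpM2r// ltW.
have h4 : e * Gbar s <= e * Gbar x by rewrite ler_wpM2l// ltW.
have -> : (E - eta) * Gbar x = E * Gbar x - 4 * (e * Gbar x) by rewrite /e; field.
move: h2; rewrite mulrBl mul1r mulrBr mulrA => h2.
move: h1; rewrite mulrBl -mulrA => h1.
move: lower pairs h1 h2 h3 h4.
move: (ruin_prob _ _ _ _ _) => psi; lra.
Unshelve. all: by end_near. Qed.

End RuinLower.

(** * The dominating coefficients and the main result *)

Section GrowthCondition.
Context (R : realType).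

(** Dividing by x ^ (l - 1 + omega) makes g tend to 0, and l - 1 + omega < l. *)
Lemma poly_growth (g : R -> R) l omega : (forall x, 0 <= x -> 0 < g x) ->
  (1 <= l)%N -> 0 < omega < 1 ->
  g x / x `^ ((l - 1)%:R + omega) @[x --> +oo%R] --> (0 : R) ->
  exists n1, forall n, (n1 <= n)%N -> g n%:R <= n%:R ^+ l.
Proof.
move=> g_pos lpos /andP[w0 w1] /cvgr0_norm_lt /(_ _ ltr01) h.
apply: (near_pinfty_nat (Q := fun x => g x <= x ^+ l)).
near=> x.
have x1 : 1 <= x by near: x; apply: nbhs_pinfty_ge; exact: num_real.
have x0 : 0 < x by rewrite (lt_le_trans _ x1).
have : `|g x / x `^ ((l - 1)%:R + omega)| < 1 by near: x.
have p0 : 0 < x `^ ((l - 1)%:R + omega) by rewrite powR_gt0.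
rewrite ger0_norm ?divr_ge0 ?(ltW (g_pos _ (ltW x0))) ?(ltW p0)//.
rewrite ltr_pdivrMr// mul1r => /ltW /le_trans; apply.
rewrite -powR_mulrn ?(ltW x0)// ler_powR//.
by rewrite natrB//; lra.
Unshelve. all: by end_near. Qed.

End GrowthCondition.

Theorem theorem1p4 (R : realType) (d : measure_display) (T : measurableType d)
    (P : probability T R)
    (Y Z : nat -> {RV P >-> R}) (tau : {RV P >-> R}) (c : R)
    (G H : probability (measurableTypeR R) R)
    (gU gL : nat -> R) (g : R -> R) (l : nat) (omega : R)
    (* the renewal risk model *)
    (GY : identically_distributed Y G) (HZ : identically_distributed Z H)
    (G_nneg : supported_nneg G) (H_nneg : supported_nneg H)
    (muG : (0 < mean G < +oo)%E) (muH : (0 < mean H < +oo)%E)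
    (tau_ge0 : forall w, 0 <= tau w)
    (lambda0 :
      ereal_inf [set t%:E | t in [set t : R | (0 < renewal_fun Z t < +oo)%E]]
        = 0%E)
    (c_gt0 : 0 < c) (safety : (mean G < c%:E * mean H)%E)
    (* dependence structure *)
    (indep : independent3 P (sigma_seq Y) (sigma_seq Z) (sigma_rv tau))
    (dep : ~ independent_seq Y \/ ~ independent_seq Z)
    (* claim sizes and inter-arrival times *)
    (Y_ENOD : ENOD Y) (G_C : consistently_varying G)
    (Z_WOD : WOD Z gU gL)
    (* the growth condition on the dominating coefficients *)
    (g_gt0 : forall x, 0 <= x -> 0 < g x) (g_incr : almost_increasing g)
    (l_ge1 : (1 <= l)%N) (omega01 : 0 < omega < 1)
    (EZgZ : P.-integrable setT (fun w => (Z 0%N w * g (Z 0%N w))%:E))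
    (g_lower : almost_decreasing_to0 (fun x => x ^+ (l - 1) / g x))
    (g_upper : almost_decreasing_to0 (fun x => g x / x `^ ((l - 1)%:R + omega)))
    (gUL : forall n, (1 <= n)%N -> Num.max (gU n) (gL n) <= g n%:R)
    (* the tails of H and of tau *)
    (H_o : tail H =o_ (pinfty_nbhs R) tail G)
    (tau_o : (fun x : R => fine (P [set w | x < tau w]))
               =o_ (pinfty_nbhs R) tail G) :
  (maxe 'E_P[tau] (mean_count Z tau) < +oo)%E /\
  ruin_prob Y Z tau c ~_ (pinfty_nbhs R)
    (fun x : R => fine (mean_count Z tau) * tail G x).
Proof.
have [M M_gt0 YW] := Y_ENOD.
have Y_law := tail_rv GY.
have Y_ge0 := rv_ge0_ae GY G_nneg.
have Z_ge0 := rv_ge0_ae HZ H_nneg.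
have Y_UOD n (x : nat -> R) : (1 <= n)%N ->
    fine (P (\bigcap_(i < n) [set w | x i < Y i w])) <=
      M * \prod_(i < n) fine (P [set w | x i < Y i w]).
  by move=> n1; have [_ _ /(_ x)[]] := YW n n1.
have Z_LOD n (x : nat -> R) : (1 <= n)%N ->
    fine (P (\bigcap_(i < n) [set w | Z i w <= x i])) <=
      gL n * \prod_(i < n) fine (P [set w | Z i w <= x i]).
  by move=> n1; have [_ _ /(_ x)[]] := Z_WOD n n1.
have gL_gt0 n : (1 <= n)%N -> 0 < gL n by move=> n1; have [] := Z_WOD n n1.
have G_gt0 := consistently_varying_gt0 G_C.
have G_nincr := @tail_nonincreasing R G.
have G_cv : forall eta : R, 0 < eta < 1 -> exists2 y, 1 < y &
    \forall x \near +oo%R, (1 - eta) * tail G x <= tail G (x * y).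
  move=> eta /(consistently_varying_near G_C)[y y1 h]; exists y => //.
  by apply: filterS h => x [].
have [mG0 mGoo] := andP muG; have [mH0 _] := andP muH.
have G_mean := tail_sum_le_mean G_nneg mGoo.
set mu := fine (mean G) in G_mean.
have mu0 : 0 < mu by rewrite fine_gt0// mG0.
have tau_small e : 0 < e ->
    \forall x \near +oo%R, fine (P [set w | x < tau w]) <= e * tail G x.
  move=> e0; have /littleo_pinftyP/(_ _ e0) := tau_o.
  apply: filterS => x; rewrite !ger0_norm ?fine_prob_ge0//; exact: tail_ge0.
have gL_poly : exists l n1, forall n, (n1 <= n)%N -> gL n <= n%:R ^+ l.
  have [n1 hn1] := poly_growth g_gt0 l_ge1 omega01 g_upper.2.
  exists l, (maxn 1 n1) => n; rewrite geq_max => /andP[n0 nn1].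
  apply: le_trans (hn1 n nn1); apply: le_trans (gUL n n0).
  by rewrite le_max lexx orbT.
have [b0 b0_gt0 Hb0] := mean_gt0_tail_gt0 H_nneg mH0.
(* b <= 1 keeps the rate b * delta / 4 below 1, as scaling Gbar requires. *)
pose b := Num.min b0 1.
have b01 : 0 < b <= 1 by rewrite lt_min b0_gt0 ltr01 ge_min lexx orbT.
have delta01 : 0 < tail H b <= 1.
  rewrite (lt_le_trans Hb0) ?tail_nonincreasing ?ge_min ?lexx//=.
  by rewrite tailE fine_prob_le1.
have Z_law i : fine (P [set w | Z i w <= b]) <= 1 - tail H b.
  rewrite -(tail_rv HZ i) -fine_probC; last first.
    by apply: measurable_ltr_set => //; exact: measurable_funPT.
  rewrite le_eqVlt; apply/orP; left; apply/eqP; congr (fine (P _)).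
  by apply/seteqP; split => w /=; rewrite leNgt => /negP.
pose q n := fine (P (renewed Z tau n)).
have q_ge0 n : 0 <= q n by exact: fine_prob_ge0.
have q_nincr n : q n.+1 <= q n.
  apply: le_fine_prob_ae; [exact: measurable_renewed|exact: measurable_renewed|].
  by apply: nearW => w; exact: renewed_nincr.
have q_o := renewed_prob_small G_gt0 G_nincr G_cv Z_ge0 Z_LOD gL_gt0 gL_poly b01
  delta01 Z_law tau_small.
have [n1 hn1] := q_o 1 ltr01.
have q_bound : forall K, \sum_(0 <= n < K) q n.+1 <= n1%:R + mu.
  apply: (tail_dominated_sum_le (u := q) (tail_ge0 G) G_mean).
    by move=> n; rewrite q_ge0/= fine_prob_le1//; exact: measurable_renewed.
  by move=> n /hn1; rewrite mul1r.
have mc_le : (mean_count Z tau <= (n1%:R + mu)%:E)%E.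
  by rewrite mean_countE//; exact: (nneseries_EFin_le (u := fun n => q n.+1)).
have mc_ge0 : (0 <= mean_count Z tau)%E.
  by rewrite mean_countE//; apply: nneseries_ge0 => n _ _; rewrite lee_fin fine_prob_ge0.
have mc_fin : mean_count Z tau \is a fin_num.
  by rewrite ge0_fin_numE// (le_lt_trans mc_le)// ltry.
set E := fine (mean_count Z tau).
have mcE : mean_count Z tau = E%:E by rewrite fineK.
have E_ge0 : 0 <= E by exact: fine_ge0.
have q_sum K : \sum_(0 <= n < K) q n.+1 <= E.
  by rewrite -lee_fin -mcE mean_countE//; exact: (nneseries_EFin_ge (u := fun n => q n.+1)).
split.
  rewrite gt_max mcE ltry andbT.
  have [n2 hn2] := near_pinfty_nat (tau_small 1 ltr01).
  apply: le_lt_trans (expectation_le_tail_sum tau_ge0 (b := n2%:R + mu) _) _; last exact: ltry.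
  apply: (tail_dominated_sum_le (u := fun n => fine (P [set w | n%:R < tau w])) (tail_ge0 G) G_mean).
    move=> n; rewrite fine_prob_ge0/= fine_prob_le1//.
    by apply: measurable_ltr_set => //; exact: measurable_funPT.
  by move=> n /hn2; rewrite mul1r.
pose s n x := fine (P [set w | x < \sum_(i < n) Y i w]).
have s_fixed n (eps x : R) : 0 < x -> 0 < eps < 1 ->
    s n x <= n%:R * tail G ((1 - eps) * x) + (n * n)%:R * (M * tail G (eps * x / n%:R) ^+ 2).
  by move=> x0 e01; exact: (fixed_sum_bound Y_law Y_ge0 M_gt0 Y_UOD).
have s_large n r (x : R) : (0 < n)%N -> 0 < x ->
    s n x <= n%:R * tail G (x / r.+1%:R) + M * expR 1 * (mu * r.+1%:R * (n%:R / x)) ^+ r.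
  by move=> n0 x0; exact: (large_sum_bound Y_law Y_ge0 M_gt0 Y_UOD G_mean).
have upper (eta : R) : 0 < eta ->
    \forall x \near +oo%R, ruin_prob Y Z tau c x <= (E + eta) * tail G x.
  move=> eta0.
  have h := random_sum_tail G_gt0 G_nincr G_cv G_mean q_ge0 q_nincr q_o q_sum M_gt0
    s_fixed s_large eta0.
  near=> x; have x0 : 0 < x by near: x; exact: nbhs_pinfty_gt.
  apply: le_trans (ruin_prob_le tau_ge0 c_gt0 Y_ge0 Z_ge0 indep (Num.truncn x) (ltW x0)) _.
  have hx : forall K, K = Num.truncn x -> q K.+1 + \sum_(0 <= n < K)
    (q n.+1 - q n.+2) * s n.+1 x <= (E + eta) * tail G x by near: x; exact: h.
  exact: hx.
have lower (eta : R) : 0 < eta ->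
    \forall x \near +oo%R, (E - eta) * tail G x <= ruin_prob Y Z tau c x.
  move=> eta0.
  exact: (ruin_lower c_gt0 Y_ge0 Z_ge0 indep Y_law M_gt0 Y_UOD G_gt0 G_nincr G_cv
    G_mean tau_small mcE eta0).
(* If E N = 0, the equivalence asserts that ruin is eventually impossible. *)
apply: equiv_pinftyP => e e0; have [E0|E_neq0] := eqVneq E 0.
  near=> x; have x0 : 0 < x by near: x; exact: nbhs_pinfty_gt.
  have q0 n : q n.+1 = 0.
    apply/eqP; rewrite eq_le q_ge0 andbT -E0; apply: le_trans (q_sum n.+1).
    by rewrite big_nat_recr//= lerDr sumr_ge0.
  have := ruin_prob_le tau_ge0 c_gt0 Y_ge0 Z_ge0 indep 0 (ltW x0).
  rewrite big_geq// addr0 -/(q 1) q0 => psi0.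
  have -> : ruin_prob Y Z tau c x = 0.
    by apply/eqP; rewrite eq_le psi0; exact: fine_prob_ge0.
  by rewrite E0 mul0r subrr normr0 mulr0.
have E_gt0 : 0 < E by rewrite lt0r E_neq0.
have eE : 0 < e * E by rewrite mulr_gt0.
have hu := upper _ eE; have hl := lower _ eE.
near=> x.
have hux : ruin_prob Y Z tau c x <= (E + e * E) * tail G x by near: x.
have hlx : (E - e * E) * tail G x <= ruin_prob Y Z tau c x by near: x.
rewrite (ger0_norm (_ : 0 <= E * tail G x)); last by rewrite mulr_ge0// tail_ge0.
rewrite ler_norml; move: hux hlx.
rewrite mulrDl mulrBl -mulrA.
move: (ruin_prob _ _ _ _ _) => psi h1 h2; apply/andP; split; lra.
Unshelve. all: by end_near. Qed.
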